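(* Let $\Gamma$ be a graph with a fixed orientation, $v_0$ a vertex of $\Gamma$, and $D^\dagger$ a divisor of degree $k+d$ on $\Gamma$. Let $X=X_\Gamma$ be the tropical curve associated to $\Gamma$ (all edges of length 1), $p_0\in X$ the point corresponding to $v_0$, and $\mu$ a degree-$k$ polarization on $X$ induced by a polarization on $\Gamma$. Let $f\colon\{1,\dots,d\}\to E(\Gamma)$ be a function and $S=\{Q_0,\dots,Q_n\}$ a set of $n+1$ vertices of the hypercube $\mathcal H_f$. Let $\mathcal D^\dagger$ be the divisor on $X$ induced by $D^\dagger$, and suppose that the image of the (relative) interior $\mathrm{Conv}(S)^\circ$ under the tropical Abel map $\alpha^{\mathrm{trop}}_{d,\mathcal D^\dagger}\colon X^d\to J^{\mathrm{trop}}_{p_0,\mu}(X)$ is contained in an open cell $\mathcal P^\circ_{\mathcal E,D}\subset J^{\mathrm{trop}}_{p_0,\mu}(X)$ for some pseudo-divisor $(\mathcal E,D)$ on $\Gamma$. Then: (1) for every $i,j\in\{0,\dots,n\}$ and every edge $e\in E(\Gamma)$, $$\Big|\big(a^e_{Q_i}(t(e))+b^e_{Q_i}(D^\dagger)\big)-\big(a^e_{Q_j}(t(e))+b^e_{Q_j}(D^\dagger)\big)\Big|\le 1;$$ (2) for every function $j\colon E(\Gamma)\to\{0,\dots,n\}$ and every proper subset $W\subsetneq V(\Gamma)$ with $v_0\in W$, $$-\frac{\delta_W}{2}<\deg(D^\dagger|_W)-\mu(W)-d+\sum_{e\in E(\Gamma)}\Big(a^e_{Q_{j(e)}}(W)-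b^e_{Q_{j(e)}}(W,D^\dagger)\Big)\le\frac{\delta_W}{2}.$$
   Context: Graphs are finite and connected. For an oriented edge $e$, $s(e)$ and $t(e)$ are its source and target. A divisor on $\Gamma$ is a function $V(\Gamma)\to\mathbb Z$. For $W\subset V(\Gamma)$, $\delta_W$ is the number of edges between $W$ and $W^c=V(\Gamma)\setminus W$. A degree-$k$ polarization on $\Gamma$ is a function $\mu\colon V(\Gamma)\to\mathbb R$ with total sum $k$; $\mu(W)=\sum_{v\in W}\mu(v)$. It induces a polarization on $X$, zero outside $V(\Gamma)$. **Tropical curve.** $X=X_\Gamma$ is the metric graph with each edge $e$ identified with $[0,1]$, $0=s(e)$, $1=t(e)$; $p_{e,r}$ is the point of $e$ at distance $r$ from $s(e)$. A divisor on $X$ is a finitely supported function $X\to\mathbb Z$; a rational function on $X$ is a continuous piecewise linear function with integer slopes; $\mathrm{div}(f)=\sum_p\mathrm{ord}_p(f)p$, $\mathrm{ord}_p(f)$ being the sum of the incoming slopes at $p$; divisors differing by some $\mathrm{div}(f)$ are equivalent, and $[\cdot]$ denotes the class. **Quasistability.** For a divisor $D$ of degree $k$ on a graph with degree-$k$ polarization $\mu$, put $\beta_D(V)=\deg(D|_V)-\mu(V)+\delta_V/2$; $D$ is $(v_0,\mu)$-quasistable if $\beta_D(V)\ge0$ for every proper subset $V$ of vertices, strictly if $v_0\in V$. Every degree-$k$ divisor $D$ on $\Gamma$ is equivalent (on $\Gamma$, i.e. modulo $\mathrm{Im}(\partial\delta)$, where $\delta(v)=\sum_{t(e)=v}e-\sum_{s(e)=v}e$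 for $v\in V(\Gamma)$ and $\partial(e)=t(e)-s(e)$ for $e\in E(\Gamma)$, extended linearly) to a unique $(v_0,\mu)$-quasistable divisor $\mathrm{qs}(D)$. For $\mathcal E\subset E(\Gamma)$, $\Gamma^{\mathcal E}$ is obtained by inserting one exceptional vertex inside each edge of $\mathcal E$. A pseudo-divisor $(\mathcal E,D)$ is such an $\mathcal E$ with a divisor $D$ on $\Gamma^{\mathcal E}$ of value $-1$ at exceptional vertices; it is $(v_0,\mu)$-quasistable if $D$ is so on $\Gamma^{\mathcal E}$, with $\mu$ extended by 0. Every degree-$k$ class on $X$ contains a unique $(p_0,\mu)$-quasistable divisor, characterized as the divisor in the class of the form $\sum_{v\in V(\Gamma)}D(v)v-\sum_{e\in\mathcal E}p_{e,x_e}$ with $x_e\in(0,1)$ and $(\mathcal E,D)$ a $(v_0,\mu)$-quasistable pseudo-divisor. $J^{\mathrm{trop}}_{p_0,\mu}(X)$ is the polyhedral complex of all degree-$k$ classes, the disjoint union of open cells $\mathcal P^\circ_{\mathcal E,D}\cong(0,1)^{\mathcal E}$ over quasistable $(\mathcal E,D)$, where $\mathcal P^\circ_{\mathcal E,D}$ consists of the classes with representative of the form $\sum_{v\in V(\Gamma)}D(v)v-\sum_{e\in\mathcal E}p_{e,x_e}$, $x_e\in(0,1)$, for the given $(\mathcal E,D)$. **Tropical Abel map and hypercube.** $\alpha^{\mathrm{trop}}_{d,\mathcal D^\dagger}(p_1,\dots,p_d)=[\mathcal D^\dagger-\sum_i p_i]$. $\mathcal H_f=\prod_{k=1}^d f(k)\cong[0,1]^d$,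 mapping naturally to $X^d$. A vertex $Q\in\{0,1\}^d$ of $\mathcal H_f$ is labelled by $(v_1,\dots,v_d)$, where $v_k=\delta_k(Q)$ is the endpoint of $f(k)$ given by the $k$-th coordinate ($s(f(k))$ for $0$, $t(f(k))$ for $1$). $\mathrm{div}(Q)=-\sum_k\delta_k(Q)$, a divisor on $\Gamma$. **Numbers $a$.** $a^e_Q(v)=\#\{k: f(k)=e,\ \delta_k(Q)=v\}$ for $v\in V(\Gamma)$; for $W\subset V(\Gamma)$, $a^e_Q(W)=\#\{k: f(k)=e,\ \delta_k(Q)\notin W\}$. **Numbers $b$.** $\delta\colon C_0(\Gamma,\mathbb Z)\to C_1(\Gamma,\mathbb Z)$ is $\delta(v)=\sum_{t(e)=v}e-\sum_{s(e)=v}e$, and $\partial(e)=t(e)-s(e)$; 0-chains are identified with divisors. For a degree-$k$ divisor $D$ write $D-\mathrm{qs}(D)=\partial\delta(M_D)$ with $M_D=\sum_v m_v v\in C_0(\Gamma,\mathbb Z)$, and $\phi_D=\delta(M_D)=\sum_e(m_{t(e)}-m_{s(e)})e$ (uniquely determined by $D$). Set $b^e_Q(D^\dagger)=\phi_{D^\dagger+\mathrm{div}(Q)}(e)$. For $W\subset V(\Gamma)$: $b^e_Q(W,D^\dagger)=b^e_Q(D^\dagger)$ if $t(e)\in W$, $s(e)\notin W$; $=-b^e_Q(D^\dagger)$ if $t(e)\notin W$, $s(e)\in W$; $=0$ otherwise. *)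

(* Defs.v *)
From HB Require Import structures.
From mathcomp Require Import all_boot all_order all_algebra.
From mathcomp Require Import all_classical all_reals all_analysis.
From mathcomp Require Import freeg.

Set Implicit Arguments.
Unset Strict Implicit.
Unset Printing Implicit Defensive.

Import Order.TTheory GRing.Theory Num.Theory.
Import numFieldNormedType.Exports.
Local Open Scope classical_set_scope.
Local Open Scope ring_scope.

(* Loops and multiple edges are allowed. *)
Record graph := Graph {
  vert : finType;
  edge : finType;
  src : edge -> vert;
  tgt : edge -> vert
}.

Definition adjacent (G : graph) : rel (vert G) := fun u v =>
  [exists e : edge G, ((src e == u) && (tgt e == v))
                   || ((src e == v) && (tgt e == u))].

Definition graph_connected (G : graph) : Prop :=
  forall u v : vert G, connect (@adjacent G) u v.

Definition divisor (G : graph) := {ffun vert G -> int}.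

Definition deg_on (G : graph) (D : divisor G) (W : {set vert G}) : int :=
  \sum_(v in W) D v.

Definition degree (G : graph) (D : divisor G) : int := \sum_v D v.

Definition cut_size (G : graph) (W : {set vert G}) : nat :=
  #|[set e : edge G | (src e \in W) != (tgt e \in W)]%SET|.

(* delta(M) = sum_e (m_{t(e)} - m_{s(e)}) e, and the coefficient of v in the
   boundary of c, where the boundary of e is t(e) - s(e). *)
Definition coboundary (G : graph) (M : {ffun vert G -> int}) :
  {ffun edge G -> int} := [ffun e => M (tgt e) - M (src e)].

Definition boundary (G : graph) (c : {ffun edge G -> int}) : divisor G :=
  [ffun v => \sum_(e | tgt e == v) c e - \sum_(e | src e == v) c e].

Definition graph_equiv (G : graph) (D D' : divisor G) : Prop :=
  exists M : {ffun vert G -> int}, D - D' = boundary (coboundary M).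

Definition polarization (R : realType) (G : graph) (k : int)
  (mu : vert G -> R) : Prop := \sum_v mu v = k%:~R.

Definition mu_on (R : realType) (G : graph) (mu : vert G -> R)
  (W : {set vert G}) : R := \sum_(v in W) mu v.

Definition beta (R : realType) (G : graph) (mu : vert G -> R) (D : divisor G)
  (W : {set vert G}) : R :=
  (deg_on D W)%:~R - mu_on mu W + (cut_size W)%:R / 2.

Definition quasistable (R : realType) (G : graph) (v0 : vert G)
  (mu : vert G -> R) (D : divisor G) : Prop :=
  forall W : {set vert G}, W \proper [set: vert G]%SET ->
    0 <= beta mu D W /\ (v0 \in W -> 0 < beta mu D W).

(* Existence and uniqueness hold when G is connected and mu is a polarization
   of degree [degree D]; the default values of xget are then irrelevant, and the
   coboundary of qs_potential does not depend on the potential chosen. *)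
Definition qs (R : realType) (G : graph) (v0 : vert G) (mu : vert G -> R)
  (D : divisor G) : divisor G :=
  xget D [set D' | graph_equiv D D' /\ quasistable v0 mu D'].

Definition qs_potential (R : realType) (G : graph) (v0 : vert G)
  (mu : vert G -> R) (D : divisor G) : {ffun vert G -> int} :=
  xget 0 [set M | D - qs v0 mu D = boundary (coboundary M)].

Definition phi (R : realType) (G : graph) (v0 : vert G) (mu : vert G -> R)
  (D : divisor G) : {ffun edge G -> int} :=
  coboundary (qs_potential v0 mu D).

(* An edge e of EE, with exceptional vertex x, becomes
   inl e : s(e) -> x and inr e : x -> t(e). *)
Definition subdivision (G : graph) (EE : {set edge G}) : graph :=
  @Graph (vert G + {e : edge G | e \in EE})%type
         (edge G + {e : edge G | e \in EE})%type
    (fun e => match e with inl e => inl (src e) | inr x => inr x end)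
    (fun e => match e with
              | inl e => if insub e is Some x then inr x else inl (tgt e)
              | inr x => inl (tgt (val x))
              end).

Definition extend_mu (R : realType) (G : graph) (EE : {set edge G})
  (mu : vert G -> R) (w : vert (subdivision EE)) : R :=
  match w with inl v => mu v | inr _ => 0 end.

Definition pseudo_divisor (G : graph) (EE : {set edge G})
  (D : divisor (subdivision EE)) : Prop :=
  forall x : {e : edge G | e \in EE}, D (inr x) = -1.

Definition quasistable_pseudo_divisor (R : realType) (G : graph) (v0 : vert G)
  (k : int) (mu : vert G -> R) (EE : {set edge G})
  (D : divisor (subdivision EE)) : Prop :=
  [/\ pseudo_divisor D, degree D = k
    & quasistable (inl v0 : vert (subdivision EE)) (extend_mu mu) D].

(* The points of X: the vertices, and the interior points of the edges given by
   their distance to the source. *)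
Definition curve (R : realType) (G : graph) :=
  (vert G + edge G * {r : R | 0 < r < 1})%type.

Definition edge_point (R : realType) (G : graph) (e : edge G) (r : R) :
  curve R G :=
  if insub r is Some u then inr (e, u)
  else if r <= 0 then inl (src e) else inl (tgt e).

Definition curve_divisor (R : realType) (G : graph) := {freeg (curve R G)}.

(* A function on X is continuous iff it is so on every closed edge, since X is
   a finite gluing of closed edges. Here s is a finite list of breakpoints. *)
Definition continuous_pl_int (R : realType) (g : R -> R) : Prop :=
  {within `[0, 1], continuous g} /\
  exists s : seq R, forall a b : R, 0 <= a -> a < b -> b <= 1 ->
    (forall c, c \in s -> ~~ (a < c < b)) ->
    exists m : int, forall x y : R, a < x < b -> a < y < b ->
      g y - g x = m%:~R * (y - x).

Definition rational_function (R : realType) (G : graph)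
  (f : curve R G -> R) : Prop :=
  forall e : edge G, continuous_pl_int (fun r => f (edge_point e r)).

(* Slopes of the germs of g at r on the right and on the left, in the direction
   of increasing argument; a default value if such an integer does not exist. *)
Definition right_slope (R : realType) (g : R -> R) (r : R) : int :=
  xget 0 [set m : int | \forall h \near (0 : R)^'+,
                          g (r + h) = g r + m%:~R * h].

Definition left_slope (R : realType) (g : R -> R) (r : R) : int :=
  xget 0 [set m : int | \forall h \near (0 : R)^'+,
                          g (r - h) = g r - m%:~R * h].

(* Sum of the slopes of f towards p; a loop contributes both of its ends. *)
Definition ord_at (R : realType) (G : graph) (f : curve R G -> R)
  (p : curve R G) : int :=
  match p with
  | inl v => \sum_(e | tgt e == v) left_slope (fun r => f (edge_point e r)) 1
             - \sum_(e | src e == v) right_slope (fun r => f (edge_point e r)) 0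
  | inr (e, u) => left_slope (fun r => f (edge_point e r)) (val u)
                  - right_slope (fun r => f (edge_point e r)) (val u)
  end.

Definition is_div (R : realType) (G : graph) (f : curve R G -> R)
  (D : curve_divisor R G) : Prop :=
  forall p, coeff p D = ord_at f p.

Definition divisor_class (R : realType) (G : graph) (D : curve_divisor R G) :
  set (curve_divisor R G) :=
  [set D' | exists2 f : curve R G -> R, rational_function f & is_div f (D - D')].

Definition induced_divisor (R : realType) (G : graph) (D : divisor G) :
  curve_divisor R G := \sum_v << (inl v : curve R G) >> *~ D v.

Definition tropical_abel (R : realType) (G : graph) (d : nat)
  (D : curve_divisor R G) (p : 'I_d -> curve R G) : set (curve_divisor R G) :=
  divisor_class (D - \sum_i << p i >>).

Definition open_cell (R : realType) (G : graph) (EE : {set edge G})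
  (D : divisor (subdivision EE)) : set (set (curve_divisor R G)) :=
  [set c | exists2 x : edge G -> R,
     (forall e, e \in EE -> 0 < x e < 1)
     & c = divisor_class
             (\sum_(v : vert G) << (inl v : curve R G) >> *~ D (inl v)
              - \sum_(e in EE) << edge_point e (x e) >>)].

Arguments open_cell R {G EE} D.

Definition affine_hull (R : realType) (d : nat) (A : set 'rV[R]_d) :
  set 'rV[R]_d :=
  [set x | exists m (p : 'I_m -> 'rV[R]_d) (c : 'I_m -> R),
     [/\ forall i, A (p i), \sum_i c i = 1 & x = \sum_i c i *: p i]].

Definition convex_hull (R : realType) (d : nat) (A : set 'rV[R]_d) :
  set 'rV[R]_d :=
  [set x | exists m (p : 'I_m -> 'rV[R]_d) (c : 'I_m -> R),
     [/\ forall i, A (p i), forall i, 0 <= c i, \sum_i c i = 1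
       & x = \sum_i c i *: p i]].

Definition relative_interior (R : realType) (d : nat) (A : set 'rV[R]_d) :
  set 'rV[R]_d :=
  [set x | A x /\ \forall y \near x, affine_hull A y -> A y].

(* Vertices of the cube are boolean vectors, with true standing for 1. *)
Definition cube_vertex (R : realType) (d : nat) (Q : {ffun 'I_d -> bool}) :
  'rV[R]_d := \row_k (Q k)%:R.

Definition cube_map (R : realType) (G : graph) (d : nat) (f : 'I_d -> edge G)
  (x : 'rV[R]_d) : 'I_d -> curve R G := fun k => edge_point (f k) (x 0 k).

Definition label (G : graph) (d : nat) (f : 'I_d -> edge G)
  (Q : {ffun 'I_d -> bool}) (k : 'I_d) : vert G :=
  if Q k then tgt (f k) else src (f k).

Definition div_vertex (G : graph) (d : nat) (f : 'I_d -> edge G)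
  (Q : {ffun 'I_d -> bool}) : divisor G :=
  [ffun v => - (#|[set k | label f Q k == v]%SET|%:Z)].

Definition a_at (G : graph) (d : nat) (f : 'I_d -> edge G)
  (Q : {ffun 'I_d -> bool}) (e : edge G) (v : vert G) : nat :=
  #|[set k | (f k == e) && (label f Q k == v)]%SET|.

Definition a_on (G : graph) (d : nat) (f : 'I_d -> edge G)
  (Q : {ffun 'I_d -> bool}) (e : edge G) (W : {set vert G}) : nat :=
  #|[set k | (f k == e) && (label f Q k \notin W)]%SET|.

Definition b_at (R : realType) (G : graph) (v0 : vert G) (mu : vert G -> R)
  (d : nat) (f : 'I_d -> edge G) (D : divisor G) (Q : {ffun 'I_d -> bool})
  (e : edge G) : int :=
  phi v0 mu (D + div_vertex f Q) e.

Definition b_on (R : realType) (G : graph) (v0 : vert G) (mu : vert G -> R)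
  (d : nat) (f : 'I_d -> edge G) (D : divisor G) (Q : {ffun 'I_d -> bool})
  (e : edge G) (W : {set vert G}) : int :=
  if (tgt e \in W) && (src e \notin W) then b_at v0 mu f D Q e
  else if (tgt e \notin W) && (src e \in W) then - b_at v0 mu f D Q e
  else 0.

(* Main.v *)
(* Let x run over the combinations of the Q_i with positive coefficients, all of
   which are in the relative interior of Conv(S), and let F_x be a rational
   function whose divisor is the difference between D^dagger - sum_k x_k and the
   quasistable representative, whose parameters y_e lie in (0,1). Along an edge
   e, the increment of F_x is
     sigma_e + sum_{f(k)=e} (1 - x_k) - [e in EE] (1 - y_e),
   where the initial slope sigma_e is an integer and the boundary of sigma does
   not depend on x. Two choices of sigma differ by an integral cycle, which is
   orthogonal to the difference of the increments; as y_e stays off 0 and 1, this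
   forces sigma to be locally constant, hence constant. Near a vertex Q of the
   hypercube, rounding a translate of F_x at the vertices of the graph yields an
   integral potential with coboundary
     sigma_e + #{k : f(k) = e, Q_k = 0} - [e in U]
   for some subset U of EE. Subtracting the corresponding principal divisor from
   D^dagger + div(Q) leaves the specialization of (EE, D) that moves the
   exceptional vertex of e to s(e) if e is in U and to t(e) otherwise. Such
   specializations are quasistable, so that this coboundary is phi. Thus
   a^e(t(e)) + b^e is independent of Q up to [e in U], and the sum in (2) computes
   the degree on W of the specialization for the set of those e with
   e in U_{j(e)}, which is again quasistable. *)

Require Import Defs.
From mathcomp Require Import all_boot all_order all_algebra.
From mathcomp Require Import all_classical all_reals all_analysis.
From mathcomp Require Import freeg.
From mathcomp Require Import ring lra zify.

Set Implicit Arguments.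
Unset Strict Implicit.
Unset Printing Implicit Defensive.

Import Order.TTheory GRing.Theory Num.Theory.
Import numFieldNormedType.Exports.
Local Open Scope classical_set_scope.
Local Open Scope ring_scope.

(** * Piecewise linear functions on the unit interval *)

(** The choice made by [xget] is forced: two integers that are slopes on right neighbourhoods of 0
    are compared at a common small [h > 0]. *)
Lemma right_slope_affine (R : realType) (g : R -> R) (a b : R) (m : int) :
  a < b -> (forall x, a < x < b -> g x = g a + m%:~R * (x - a)) ->
  right_slope g a = m.
Proof.
move=> ab gE; rewrite /right_slope.
have near_m : \forall h \near (0 : R)^'+, g (a + h) = g a + m%:~R * h.
  near=> h; rewrite gE; first by congr (_ + _ * _); ring.
  by rewrite ltrDl -ltrBrDl; apply/andP; split; near: h;
    [exact: nbhs_right_gt | apply: nbhs_right_lt; rewrite subr_gt0].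
have := @xgetPex _ 0 [set m0 : int | \forall h \near (0 : R)^'+,
  g (a + h) = g a + m0%:~R * h] (ex_intro _ m near_m).
move: (xget _ _) => m' /= near_m'.
near (0 : R)^'+ => h.
have h0 : 0 < h by near: h; exact: nbhs_right_gt.
have E : g (a + h) = g a + m%:~R * h by near: h.
have E' : g (a + h) = g a + m'%:~R * h by near: h.
apply/eqP; rewrite -(eqr_int R); apply/eqP.
by apply: (mulIf (lt0r_neq0 h0)); apply: (addrI (g a)); rewrite -E' E.
Unshelve. all: by end_near. Qed.

Lemma left_slope_affine (R : realType) (g : R -> R) (a b : R) (m : int) :
  a < b -> (forall x, a < x < b -> g x = g b - m%:~R * (b - x)) ->
  left_slope g b = m.
Proof.
move=> ab gE; rewrite /left_slope.
have near_m : \forall h \near (0 : R)^'+, g (b - h) = g b - m%:~R * h.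
  near=> h; rewrite gE; first by congr (_ - _ * _); ring.
  rewrite [_ < b]ltrBlDr ltrDl ltrBrDr -ltrBrDl andbC.
  by apply/andP; split; near: h;
    [exact: nbhs_right_gt | apply: nbhs_right_lt; rewrite subr_gt0].
have := @xgetPex _ 0 [set m0 : int | \forall h \near (0 : R)^'+,
  g (b - h) = g b - m0%:~R * h] (ex_intro _ m near_m).
move: (xget _ _) => m' /= near_m'.
near (0 : R)^'+ => h.
have h0 : 0 < h by near: h; exact: nbhs_right_gt.
have E : g (b - h) = g b - m%:~R * h by near: h.
have E' : g (b - h) = g b - m'%:~R * h by near: h.
apply/eqP; rewrite -(eqr_int R); apply/eqP.
apply: (mulIf (lt0r_neq0 h0)); apply: oppr_inj; apply: (addrI (g b)).
by rewrite -E' E.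
Unshelve. all: by end_near. Qed.

(** Inside the interval [g] coincides with an affine function [L]; one-sided continuity and
    uniqueness of limits extend this to both ends. *)
Lemma affine_itv_closure (R : realType) (g : R -> R) (a b m : R) : a < b ->
  {within `[a, b], continuous g} ->
  (forall x y, a < x < b -> a < y < b -> g y - g x = m * (y - x)) ->
  forall x y, a <= x <= b -> a <= y <= b -> g y - g x = m * (y - x).
Proof.
move=> ab /(continuous_within_itvP _ ab)[_ ga gb] gE.
pose c := (a + b) / 2.
have cab : a < c < b by rewrite /c; lra.
pose L (z : R) := g c + m * (z - c).
have gL z : a < z < b -> g z = L z.
  by move=> zab; rewrite /L -(gE c z) //; ring.
have cL z : L y @[y --> z] --> L z.
  apply: cvgD; first exact: cvg_cst.
  by apply: cvgMr; apply: cvgB; [exact: cvg_id | exact: cvg_cst].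
have gaE : g a = L a.
  apply: (@cvg_unique _ (@Rhausdorff R) (L x @[x --> a^'+])) => //.
    apply: cvg_trans ga; apply: near_eq_cvg; near=> z; apply: gL.
    by apply/andP; split; near: z;
      [exact: nbhs_right_gt | exact: nbhs_right_lt].
  exact/cvg_at_right_filter/cL.
have gbE : g b = L b.
  apply: (@cvg_unique _ (@Rhausdorff R) (L x @[x --> b^'-])) => //.
    apply: cvg_trans gb; apply: near_eq_cvg; near=> z; apply: gL.
    by apply/andP; split; near: z; [exact: nbhs_left_gt | exact: nbhs_left_lt].
  exact/cvg_at_left_filter/cL.
have gLc z : a <= z <= b -> g z = L z.
  case/andP; rewrite le_eqVlt => /predU1P[<- //|az].
  rewrite le_eqVlt => /predU1P[-> //|zb].
  by apply: gL; rewrite az.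
by move=> x y xab yab; rewrite !gLc // /L; ring.
Unshelve. all: by end_near. Qed.

(** Induction on the breakpoints: a slope change at [b] acts on the remaining length [1 - b], hence
    this weight in the increment and weight 1 in the final slope. *)
Lemma pl_increment_breakpoints (R : realType) (g : R -> R) :
  {within `[0, 1], continuous g} ->
  forall (B : seq R) (a : R), 0 <= a < 1 ->
  path <%R a B -> all (fun b => b < 1) B ->
  (forall u v : R, a <= u -> u < v -> v <= 1 ->
    (forall b, b \in B -> ~~ (u < b < v)) ->
    exists m : int, forall x y, u < x < v -> u < y < v ->
      g y - g x = m%:~R * (y - x)) ->
  let jump b := right_slope g b - left_slope g b in
  g 1 - g a = (right_slope g a)%:~R * (1 - a)
              + \sum_(b <- B) (jump b)%:~R * (1 - b)
  /\ left_slope g 1 = right_slope g a + \sum_(b <- B) jump b.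
Proof.
move=> gC B; elim: B => [|b B IH] a /andP[a0 a1] /= pathB B1 gE.
  have [//|m gm] := gE a 1 (lexx a) a1 (lexx 1).
  have gc : {within `[a, 1], continuous g}.
    apply: continuous_subspaceW gC => x /=; rewrite !in_itv /= => /andP[ax ->].
    by rewrite (le_trans a0 ax).
  have gmc := affine_itv_closure a1 gc gm.
  have -> : right_slope g a = m.
    apply: (right_slope_affine a1) => x /andP[ax x1].
    by rewrite -(gmc a x) ?lexx ?(ltW ax) ?(ltW x1) ?(ltW a1) //; ring.
  have -> : left_slope g 1 = m.
    apply: (left_slope_affine a1) => x /andP[ax x1].
    by rewrite -(gmc x 1) ?lexx ?(ltW ax) ?(ltW x1) ?(ltW a1) //; ring.
  by rewrite !big_nil !addr0 (gmc a 1) ?lexx ?(ltW a1).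
case/andP: pathB => ab pathB; case/andP: B1 => b1 B1.
have b0 : 0 <= b := le_trans a0 (ltW ab).
have minB c : c \in B -> b < c.
  by apply/allP: c; apply: order_path_min pathB; exact: lt_trans.
have [m gm] : exists m : int, forall x y, a < x < b -> a < y < b ->
    g y - g x = m%:~R * (y - x).
  apply: gE => //; first exact: ltW.
  move=> c; rewrite inE => /predU1P[->|/minB bc]; first by rewrite ltxx andbF.
  by rewrite [c < b]ltNge (ltW bc) andbF.
have gc : {within `[a, b], continuous g}.
  apply: continuous_subspaceW gC => x /=; rewrite !in_itv /= => /andP[ax xb].
  by rewrite (le_trans a0 ax) (le_trans xb (ltW b1)).
have gmc := affine_itv_closure ab gc gm.
have [] := IH b _ pathB B1.
- by rewrite b0.
- move=> u v bu uv v1 Buv; apply: gE => //; first exact: le_trans (ltW ab) bu.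
  move=> c; rewrite inE => /predU1P[->|/Buv //].
  by rewrite ltNge bu.
have ra : right_slope g a = m.
  apply: (right_slope_affine ab) => x /andP[ax xb].
  by rewrite -(gmc a x) ?lexx ?(ltW ax) ?(ltW xb) ?(ltW ab) //; ring.
have lb : left_slope g b = m.
  apply: (left_slope_affine ab) => x /andP[ax xb].
  by rewrite -(gmc x b) ?lexx ?(ltW ax) ?(ltW xb) ?(ltW ab) //; ring.
move=> g1 l1; rewrite !big_cons l1 ra lb; split; last by ring.
have -> : g 1 - g a = (g 1 - g b) + (g b - g a) by ring.
rewrite g1 (gmc a b) ?lexx ?(ltW ab) // rmorphB /=.
by ring.
Qed.

(** Double counting by position, where several entries of [L] may share one; it trades a sum over
    breakpoints for a sum over [L]. *)
Lemma sum_fibers (S : pzSemiRingType) (T : eqType) (B : seq T)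
    (L : seq (S * T)) (h : T -> S) :
  uniq B -> (forall q, q \in L -> q.2 \in B) ->
  \sum_(b <- B) (\sum_(q <- L) q.1 * (q.2 == b)%:R) * h b
  = \sum_(q <- L) q.1 * h q.2.
Proof.
move=> uB LB; under eq_bigr do rewrite big_distrl /=.
rewrite exchange_big /= big_seq [RHS]big_seq; apply: eq_bigr => q /LB qB.
rewrite (bigD1_seq q.2) //= eqxx mulr1 big1 ?addr0 // => b.
by rewrite eq_sym => /negbTE ->; rewrite mulr0 mul0r.
Qed.

(* A list [L] of pairs (multiplicity, position) encodes the divisor of [g] on
   the open unit interval. *)
Lemma pl_increment (R : realType) (g : R -> R) (L : seq (int * R)) :
  continuous_pl_int g ->
  (forall q, q \in L -> 0 < q.2 < 1) ->
  (forall u, 0 < u < 1 -> left_slope g u - right_slope g u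
                          = \sum_(q <- L) q.1 * (q.2 == u)%:R) ->
  g 1 - g 0 = (right_slope g 0)%:~R - \sum_(q <- L) q.1%:~R * (1 - q.2)
  /\ left_slope g 1 = right_slope g 0 - \sum_(q <- L) q.1.
Proof.
move=> [gC [s gs]] L01 gL.
(* The positions in [L] are added to the breakpoints of [g], so that every [q.2] is in [B]; at the
   other points of [B] the jump is 0. *)
pose B := sort <=%R (undup [seq b <- s ++ map snd L | 0 < b < 1]).
have BE b : (b \in B) = (b \in s ++ map snd L) && (0 < b < 1).
  by rewrite mem_sort mem_undup mem_filter andbC.
have uB : uniq B by rewrite sort_uniq undup_uniq.
have B01 b : b \in B -> 0 < b < 1 by rewrite BE => /andP[].
have pathB : path <%R 0 B.
  rewrite path_min_sorted; last by apply/allP => b /B01 /andP[].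
  by rewrite lt_sorted_uniq_le uB sort_le_sorted.
have [||u v u0 uv v1 Buv|] := pl_increment_breakpoints gC _ pathB.
- by rewrite lexx ltr01.
- by apply/allP => b /B01 /andP[].
- apply: gs => // c cs; have [cB|] := boolP (c \in B); first exact: Buv.
  rewrite BE mem_cat cs /=; apply: contra => /andP[uc cv].
  by rewrite (le_lt_trans u0 uc) (lt_le_trans cv v1).
rewrite subr0 mulr1 => -> ->.
have LB q : q \in L -> q.2 \in B.
  by move=> qL; rewrite BE L01 // mem_cat map_f ?orbT.
have jE b : b \in B -> right_slope g b - left_slope g b
    = - \sum_(q <- L) q.1 * (q.2 == b)%:R.
  by move/B01/gL <-; rewrite opprB.
split; last first.
  congr (_ + _); rewrite (eq_big_seq _ jE) sumrN; congr (- _).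
  have := sum_fibers (fun=> 1) uB LB.
  by under eq_bigr do rewrite mulr1; under [RHS]eq_bigr do rewrite mulr1.
congr (_ + _).
rewrite (eq_big_seq (fun b => - ((\sum_(q <- L) q.1%:~R * (q.2 == b)%:R)
  * (1 - b)))); last first.
  move=> b /jE ->; rewrite rmorphN rmorph_sum /= mulNr; congr (- (_ * _)).
  by apply: eq_bigr => q _; rewrite rmorphM /= natz -pmulrn.
rewrite sumrN; congr (- _).
have LB' (q : R * R) :
  q \in [seq (q0.1%:~R, q0.2) | q0 <- L] -> q.2 \in B.
  by case/mapP=> q' /LB q'B ->.
have := sum_fibers (fun b : R => 1 - b) uB LB'.
rewrite big_map => <-; apply: eq_bigr => b _.
by rewrite big_map.
Qed.

(** * Chains and quasistable divisors *)

Section Chains.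
Variable G : graph.
Implicit Types (c : {ffun edge G -> int}) (M : {ffun vert G -> int}).
Implicit Types (D : divisor G) (W : {set vert G}).

(** Summation by parts: the boundary is adjoint to the coboundary. The ring is arbitrary because
    both integral and real potentials occur. *)
Lemma sum_boundary (A : comPzRingType) (c : edge G -> A) (g : vert G -> A) :
  \sum_v g v * (\sum_(e | tgt e == v) c e - \sum_(e | src e == v) c e)
  = \sum_e c e * (g (tgt e) - g (src e)).
Proof.
have fiber (h : edge G -> vert G) :
    \sum_v g v * (\sum_(e | h e == v) c e) = \sum_e c e * g (h e).
  rewrite [RHS](partition_big h predT) //=; apply: eq_bigr => v _.
  by rewrite mulr_sumr; apply: eq_bigr => e /eqP ->; rewrite mulrC.
under eq_bigr do rewrite mulrBr.
by rewrite sumrB !fiber -sumrB; apply: eq_bigr => e _; rewrite mulrBr.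
Qed.

Lemma boundaryB c c' : boundary (c - c') = boundary c - boundary c'.
Proof.
apply/ffunP => v; rewrite !ffunE.
under eq_bigr do rewrite !ffunE.
under [X in _ - X = _]eq_bigr do rewrite !ffunE.
by rewrite !sumrB; ring.
Qed.

Lemma coboundaryB M M' : coboundary (M - M') = coboundary M - coboundary M'.
Proof. by apply/ffunP => e; rewrite !ffunE; ring. Qed.

Lemma deg_on_boundary c W :
  deg_on (boundary c) W
  = \sum_e c e * ((tgt e \in W)%:R - (src e \in W)%:R).
Proof.
rewrite -(sum_boundary c (fun v => (v \in W)%:R)) /deg_on big_mkcond /=.
by apply: eq_bigr => v _; rewrite ffunE; case: (v \in W);
  rewrite ?mul1r ?mul0r.
Qed.

Lemma degree_setT D : degree D = deg_on D [set: vert G]%SET.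
Proof. by apply: eq_bigl => v; rewrite inE. Qed.

Lemma degree_boundary c : degree (boundary c) = 0.
Proof.
by rewrite degree_setT deg_on_boundary big1 // => e _; rewrite !inE subrr mulr0.
Qed.

Lemma deg_onB D D' W : deg_on (D - D') W = deg_on D W - deg_on D' W.
Proof. by rewrite /deg_on -sumrB; apply: eq_bigr => v _; rewrite !ffunE. Qed.

(** For [N = M - M'], pairing [N] with the boundary of its coboundary gives the sum of the squares
    of the coboundary, which is therefore 0. *)
Lemma coboundary_inj M M' :
  boundary (coboundary M) = boundary (coboundary M') ->
  coboundary M = coboundary M'.
Proof.
move=> eqM; apply/eqP; rewrite -subr_eq0 -coboundaryB; apply/eqP.
have bN : boundary (coboundary (M - M')) = 0.
  by rewrite coboundaryB boundaryB eqM subrr.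
move: (M - M') bN => N bN.
have : \sum_e coboundary N e * (N (tgt e) - N (src e)) = 0.
  rewrite -sum_boundary big1 // => v _.
  by have /ffunP/(_ v) := bN; rewrite !ffunE => ->; rewrite mulr0.
under eq_bigr do rewrite ffunE -expr2.
move=> /eqP; rewrite psumr_eq0 => [/allP N0|e _]; last exact: sqr_ge0.
apply/ffunP => e; rewrite !ffunE; apply/eqP.
by have := N0 e (mem_index_enum e); rewrite sqrf_eq0.
Qed.

Lemma cut_sizeE W :
  cut_size W = (\sum_e ((src e \in W) != (tgt e \in W)))%N.
Proof.
by rewrite /cut_size -sum1_card big_mkcond /=; apply: eq_bigr => e _;
  rewrite inE; case: eqP.
Qed.

Lemma cut_sizeC W : cut_size (~: W)%SET = cut_size W.
Proof.
by apply: eq_card => e; rewrite !inE; case: (src e \in W); case: (tgt e \in W).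
Qed.

End Chains.

(** * Uniqueness of quasistable representatives *)

Section Quasistable.
Variables (R : realType) (G : graph) (v0 : vert G) (k : int) (mu : vert G -> R).
Hypothesis mu_k : polarization k mu.
Implicit Types (M : {ffun vert G -> int}) (D : divisor G) (W : {set vert G}).

(** Degree and polarization both total [k] and cancel, and each side contributes half of the cut.
    Lower bounds on [~: W] thus become upper bounds on [W]. *)
Lemma beta_setC D W : degree D = k ->
  beta mu D W + beta mu D (~: W)%SET = (cut_size W)%:R.
Proof.
move=> Dk; rewrite /beta cut_sizeC.
have degE : deg_on D W + deg_on D (~: W)%SET = k.
  rewrite -Dk /degree (bigID (mem W)) /=; congr (_ + _).
  by apply: eq_bigl => v; rewrite inE.
have muE : mu_on mu W + mu_on mu (~: W)%SET = k%:~R.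
  rewrite -mu_k (bigID (mem W)) /=; congr (_ + _).
  by apply: eq_bigl => v; rewrite inE.
move: muE; rewrite -degE rmorphD /=; lra.
Qed.

(** Let [W] be the set where [M] is maximal. Each cut edge adds at least 1 to the degree of [D - D']
    on [W], so [beta] of [D'] on [W] plus [beta] of [D] on [~: W] is at most 0. Quasistability makes
    it positive, since [v0] lies on one of the two sides; hence [M] is constant. *)
Lemma quasistable_unique D D' : degree D = k -> degree D' = k ->
  quasistable v0 mu D -> quasistable v0 mu D' -> graph_equiv D D' -> D = D'.
Proof.
move=> Dk D'k qsD qsD' [M DM].
have [vm _ maxM] : exists2 vm, true & forall v, M v <= M vm.
  pose vm := Order.arg_max v0 xpredT M; exists vm => // v.
  by rewrite /vm; case: arg_maxP => // i _; exact.
pose W : {set vert G} := [set v | M v == M vm]%SET.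
have [WT|WT] := eqVneq W [set: vert G]%SET.
  apply/eqP; rewrite -subr_eq0 DM.
  suff -> : coboundary M = 0 - 0 by rewrite boundaryB subrr.
  rewrite subrr; apply/ffunP => e; rewrite !ffunE.
  have Mvm v : M v = M vm.
    by apply/eqP; have : v \in W by [rewrite WT inE]; rewrite inE.
  by rewrite !Mvm subrr.
have Wp : W \proper [set: vert G]%SET by rewrite finset.properT.
have WCp : (~: W)%SET \proper [set: vert G]%SET.
  apply/properP; split; first exact: finset.subsetT.
  by exists vm; rewrite // !inE eqxx.
have cutW : (cut_size W)%:R <= deg_on D W - deg_on D' W.
  rewrite -deg_onB DM deg_on_boundary cut_sizeE natr_sum.
  apply: ler_sum => e _; rewrite !ffunE !inE.
  have := maxM (src e); have := maxM (tgt e).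
  by case: eqP; case: eqP => /=; lia.
have [bD bD0] := qsD _ WCp; have [bD' bD'0] := qsD' _ Wp.
have bE := beta_setC W Dk.
have bDW : beta mu D W = beta mu D' W + (deg_on D W - deg_on D' W)%:~R.
  by rewrite /beta rmorphB /=; ring.
have cutWR : (cut_size W)%:R <= (deg_on D W - deg_on D' W)%:~R :> R.
  by rewrite -(ler_int R) rmorph_nat in cutW.
have : 0 < beta mu D' W + beta mu D (~: W)%SET.
  have [v0W|v0W] := boolP (v0 \in W).
    by rewrite ltr_wpDr // bD'0.
  by rewrite ltr_wpDl // bD0 // inE.
have -> : beta mu D' W + beta mu D (~: W)%SET
    = (cut_size W)%:R - (deg_on D W - deg_on D' W)%:~R by rewrite -bE bDW; ring.
by rewrite subr_gt0 ltNge cutWR.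
Qed.

(** Uniqueness of the quasistable representative and of the coboundary makes both [xget] choices
    irrelevant, so any potential reaching a quasistable divisor computes [phi]. *)
Lemma phi_quasistable D M : degree D = k ->
  quasistable v0 mu (D - boundary (coboundary M)) ->
  phi v0 mu D = coboundary M.
Proof.
move=> Dk qsDM.
have degM N : degree (D - boundary (coboundary N)) = k.
  by rewrite degree_setT deg_onB -!degree_setT degree_boundary subr0.
have qsE : qs v0 mu D = D - boundary (coboundary M).
  have := @xgetPex _ D [set D' | graph_equiv D D' /\ quasistable v0 mu D'].
  case.
    by exists (D - boundary (coboundary M)); split=> //; exists M; rewrite subKr.
  rewrite -/(qs v0 mu D) => -[N DN] qsD.
  have qsN : qs v0 mu D = D - boundary (coboundary N) by rewrite -DN subKr.
  rewrite qsN; apply: quasistable_unique => //; first by rewrite -qsN.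
  exists (M - N); by rewrite coboundaryB boundaryB opprB addrC addrA subrK.
rewrite /phi; apply: coboundary_inj.
have /= := @xgetPex _ 0 [set N | D - qs v0 mu D = boundary (coboundary N)].
rewrite -/(qs_potential v0 mu D) => <-; first by rewrite qsE subKr.
by exists M; rewrite qsE subKr.
Qed.

End Quasistable.

(* The specialization of a pseudo-divisor that moves the exceptional vertex of
   each edge [e] to [z e]. *)
Definition specialize (G : graph) (EE : {set edge G})
    (D : divisor (subdivision EE)) (z : edge G -> vert G) : divisor G :=
  [ffun v => D (inl v) - \sum_(e in EE) (z e == v)%:R].

(** * Specializations of quasistable pseudo-divisors *)

Section Specialize.
Variables (R : realType) (G : graph) (v0 : vert G) (mu : vert G -> R).
Variables (EE : {set edge G}) (D : divisor (subdivision EE)).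
Variable z : edge G -> vert G.
Hypothesis zE : forall e, e \in EE -> z e = src e \/ z e = tgt e.
Hypothesis pseudoD : pseudo_divisor D.

(** Each exceptional vertex joins the side of the vertex it is moved to; this set then has the same
    [beta] on the subdivision as [W] has for the specialization. *)
Let lift_set (W : {set vert G}) : {set vert (subdivision EE)} :=
  [set w | match w with inl v => v \in W | inr x => z (val x) \in W end]%SET.

Lemma deg_on_specialize (W : {set vert G}) :
  deg_on (specialize D z) W
  = \sum_(v in W) D (inl v) - \sum_(e in EE) (z e \in W)%:R.
Proof.
rewrite /deg_on; under eq_bigr do rewrite ffunE.
rewrite sumrB; congr (_ - _); rewrite exchange_big /=; apply: eq_bigr => e _.
have [zW|zW] := boolP (z e \in W).
  rewrite (bigD1 (z e)) //= eqxx big1 ?addr0 // => v /andP[_].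
  by rewrite eq_sym => /negbTE ->.
rewrite big1 // => v vW; case: eqP => // zv.
by rewrite zv vW in zW.
Qed.

Lemma quasistable_specialize :
  quasistable (inl v0 : vert (subdivision EE)) (extend_mu mu) D ->
  quasistable v0 mu (specialize D z).
Proof.
move=> qsD W /properP[_ [u _ uW]].
have Wp : lift_set W \proper [set: vert (subdivision EE)]%SET.
  apply/properP; split; first exact: finset.subsetT.
  by exists (inl u); rewrite ?inE.
suff <- : beta (extend_mu mu) D (lift_set W) = beta mu (specialize D z) W.
  by have [bD bD0] := qsD _ Wp; split=> // v0W; apply: bD0; rewrite inE.
rewrite /beta; congr (_%:~R - _ + _%:R / 2).
- rewrite deg_on_specialize /deg_on big_sumType /=; congr (_ + _).
    by apply: eq_bigl => v; rewrite inE.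
  rewrite (eq_bigr (fun=> -1)) => [|x _]; last exact: pseudoD.
  rewrite sumrN; congr (- _); rewrite big_mkcond /=.
  rewrite (big_sub _ (fun e => (z e \in W)%:R)) /=.
  by apply: eq_bigr => x _; rewrite inE; case: (_ \in W).
- rewrite /mu_on big_sumType /= [X in _ + X]big1 // addr0.
  by apply: eq_bigl => v; rewrite inE.
- rewrite !cut_sizeE big_sumType /= [in RHS](bigID (mem EE)) /=.
  rewrite [X in (X + _)%N = _](bigID (mem EE)) /= addnAC; congr (_ + _)%N.
    rewrite [X in (X + _)%N]big_sub [RHS]big_sub -big_split /=.
    apply: eq_bigr => x _.
    rewrite !inE valK.
    (* The half edge between the exceptional vertex and [z] is not cut; the other half is cut
       exactly when the whole edge is. *)
    by case: (zE (valP x)) => ->; rewrite eqxx ?addn0 ?add0n.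
  apply: eq_bigr => e eE; rewrite !inE.
  by case: insubP => [x|] /=; rewrite ?(negPf eE) // inE.
Qed.

End Specialize.

(** * The slopes along a cell *)

Section EdgePoints.
Variables (R : realType) (G : graph).
Implicit Types (e : edge G) (r : R).

Lemma edge_point_inner e e' r (u : {r : R | 0 < r < 1}) :
  (edge_point e r == inr (e', u)) = (e == e') && (r == val u).
Proof.
rewrite /edge_point; case: insubP => [w _ <-|r01].
  by apply/eqP/andP => [[-> ->]|[/eqP -> /eqP /val_inj ->]].
rewrite (_ : (if _ then _ else _) == _ = false); last by case: ifP.
by apply/esym/negbTE; apply: contra r01 => /andP[_ /eqP ->]; exact: (valP u).
Qed.

Lemma edge_point_vertex e r (v : vert G) : 0 <= r <= 1 ->
  (edge_point e r == inl v)
  = ((r == 0) && (src e == v)) || ((r == 1) && (tgt e == v)).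
Proof.
move=> /andP[r0 r1]; rewrite /edge_point; case: insubP => [w wr _|].
  case/andP: wr => /lt0r_neq0 /negbTE ->.
  by rewrite lt_neqAle => /andP[/negbTE -> _].
rewrite negb_and -!leNgt => /orP[r0'|r1'].
  have -> : r = 0 by apply/eqP; rewrite eq_le r0' r0.
  by rewrite lexx eqxx [0 == 1]eq_sym oner_eq0 orbF.
have -> : r = 1 by apply/eqP; rewrite eq_le r1' r1.
by rewrite ler10 oner_eq0 eqxx.
Qed.

Lemma edge_point0 e : edge_point e (0 : R) = inl (src e).
Proof. by apply/eqP; rewrite edge_point_vertex ?lexx ?ler01 // !eqxx. Qed.

Lemma edge_point1 e : edge_point e (1 : R) = inl (tgt e).
Proof. by apply/eqP; rewrite edge_point_vertex ?lexx ?ler01 // !eqxx orbT. Qed.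

Lemma coeff_point (p q : curve R G) : coeff q << p >> = (p == q)%:R :> int.
Proof. by rewrite coeffU mul1r. Qed.

Lemma coeff_induced_vertex (m : vert G -> int) (v : vert G) :
  coeff (inl v) (\sum_w << (inl w : curve R G) >> *~ m w) = m v.
Proof.
rewrite raddf_sum (bigD1 v) //= raddfMz /= coeff_point eqxx big1 ?addr0.
  by rewrite intz.
move=> w wv; rewrite raddfMz /= coeff_point.
by rewrite (_ : (inl w == inl v :> curve R G) = false) ?mul0rz //; apply/negbTE.
Qed.

Lemma coeff_induced_inner (m : vert G -> int) p :
  coeff (inr p) (\sum_w << (inl w : curve R G) >> *~ m w) = 0 :> int.
Proof.
by rewrite raddf_sum big1 // => w _; rewrite raddfMz /= coeff_point mul0rz.
Qed.

Lemma divisor_class_refl (D : curve_divisor R G) : divisor_class D D.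
Proof.
exists (fun=> 0) => [e|p].
  split; first by apply: continuous_subspaceT => r; exact: cst_continuous.
  by exists [::] => *; exists 0 => *; rewrite subr0 mul0r.
rewrite subrr coeff0.
have rs r : right_slope (fun=> 0 : R) r = 0.
  by apply: (@right_slope_affine _ _ _ (r + 1)); [lra | move=> *; lra].
have ls r : left_slope (fun=> 0 : R) r = 0.
  by apply: (@left_slope_affine _ _ (r - 1)); [lra | move=> *; lra].
case: p => [v|[e u]] /=; last by rewrite rs ls subr0.
rewrite big1 => [|e _]; last by rewrite ls.
by rewrite big1 ?subr0 // => e _; rewrite rs.
Qed.

End EdgePoints.

Section Lift.
Variables (R : realType) (G : graph) (d : nat) (f : 'I_d -> edge G).
Variables (Ddag : divisor G) (EE : {set edge G}) (D : divisor (subdivision EE)).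

(* Let [F] be a rational function on X whose divisor is the difference between
   [Ddag - sum_k p_k], with [p_k] at position [x k] of [f k], and the point of
   the open cell with parameters [y]. Then [g] is its restriction to the
   vertices and [sigma e] its slope along [e] just before the source, where all
   the [p_k] on the closed edge [e] count as lying after that position. *)
Definition is_lift (x : 'I_d -> R) (sigma : {ffun edge G -> int}) : Prop :=
  exists (y : edge G -> R) (g : vert G -> R),
    [/\ forall e, e \in EE -> 0 < y e < 1,
        forall v, boundary sigma v = Ddag v - D (inl v)
          - \sum_(e | tgt e == v) (\sum_(k | f k == e) 1 - (e \in EE)%:R)
      & forall e, g (tgt e) - g (src e) = (sigma e)%:~R
          + \sum_(k | f k == e) (1 - x k) - (if e \in EE then 1 - y e else 0)].

(** The rational function [F] relating the two representatives of the class is analysed edge by edge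
    with [pl_increment]; the rest is bookkeeping for points [x k] at the ends of edges. *)
Lemma open_cell_lift (x : 'I_d -> R) : (forall k, 0 <= x k <= 1) ->
  open_cell R D (tropical_abel (induced_divisor R Ddag)
                   (fun k => edge_point (f k) (x k))) ->
  exists sigma, is_lift x sigma.
Proof.
move=> x01 [y y01]; rewrite /tropical_abel.
set A := induced_divisor R Ddag - _; set B := _ - _ => clAB.
have : divisor_class A B by rewrite clAB; exact: divisor_class_refl.
case=> F FQ FD.
pose g e r := F (edge_point e r).
pose inner k := 0 < x k < 1.
pose L e : seq (int * R) :=
  [seq (-1, x k) | k <- enum 'I_d & (f k == e) && inner k]
  ++ (if e \in EE then [:: (1, y e)] else [::]).
have L01 e q : q \in L e -> 0 < q.2 < 1.
  rewrite mem_cat => /orP[/mapP[k]|].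
    by rewrite mem_filter => /andP[/andP[_ ?] _] ->.
  by case: ifP => // eE; rewrite inE => /eqP ->; exact: y01.
have sumL (A' : pzRingType) e (h : int * R -> A') : \sum_(q <- L e) h q
    = \sum_(k | (f k == e) && inner k) h (-1, x k)
      + (if e \in EE then h (1, y e) else 0).
  rewrite big_cat big_map big_filter big_enum_cond /=; congr (_ + _).
  by case: ifP => _; rewrite ?big_seq1 ?big_nil.
have gL e u : 0 < u < 1 -> left_slope (g e) u - right_slope (g e) u
    = \sum_(q <- L e) q.1 * (q.2 == u)%:R.
  move=> u01; pose p : curve R G := inr (e, exist _ u u01).
  have := FD p; rewrite /= -/(g e) => <-.
  rewrite !coeffB !coeff_induced_inner sub0r sub0r opprK !raddf_sum sumL /=.
  congr (_ + _).
    rewrite big_mkcond [RHS]big_mkcond /=; apply: eq_bigr => k _.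
    rewrite coeff_point edge_point_inner /inner /=.
    case: (f k == e) => //=; case: eqP => [->|_]; first by rewrite u01 mulr1.
    by case: ifP; rewrite ?mulr0.
  rewrite mul1r big_mkcond (bigD1 e) //= big1 ?addr0.
    by rewrite coeff_point edge_point_inner eqxx; case: ifP.
  move=> e' /negbTE e'e; case: ifP => // _.
  by rewrite coeff_point edge_point_inner e'e.
have gPL e := pl_increment (FQ e) (@L01 e) (@gL e).
(* Passing a point raises the slope by 1, so the points at the source are subtracted to obtain the
   slope before them. *)
pose sigma : {ffun edge G -> int} :=
  [ffun e => right_slope (g e) 0 - \sum_(k | f k == e) (x k == 0)%:R].
have innerP k : [\/ x k = 0, x k = 1 | inner k].
  rewrite /inner; have /andP[] := x01 k.
  rewrite le_eqVlt => /predU1P[<- _|x0]; first by constructor 1.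
  rewrite le_eqVlt => /predU1P[->|x1]; first by constructor 2.
  by constructor 3; rewrite x0.
exists sigma, y, (fun v => F (inl v)); split=> // [v|e]; last first.
  have [gE _] := gPL e; move: gE; rewrite /g edge_point0 edge_point1 => ->.
  rewrite sumL ffunE /= rmorphB rmorph_sum /= mul1r.
  have -> : \sum_(k | f k == e) (1 - x k)
    = \sum_(k | f k == e) ((x k == 0)%:R : int)%:~R
      - \sum_(k | (f k == e) && inner k) (- 1)%:~R * (1 - x k).
    rewrite big_mkcondr /= -sumrB; apply: eq_bigr => k _.
    rewrite /inner; case: (innerP k) => [->|->|xk].
    - by rewrite ltxx eqxx !subr0.
    - by rewrite ltxx andbF oner_eq0 subrr subr0.
    - rewrite [0 < _ < _]xk; have /andP[/lt0r_neq0 /negbTE -> _] := xk.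
      by rewrite rmorphN1 mulN1r opprK add0r.
  have telescope (a b c s : R) : a - (b + c) = a - s + (s - b) - c by ring.
  exact: telescope.
have := FD (inl v).
rewrite -[ord_at F _]/(\sum_(e | tgt e == v) left_slope (g e) 1
                       - \sum_(e | src e == v) right_slope (g e) 0).
rewrite !coeffB !coeff_induced_vertex.
rewrite [coeff _ (\sum_k _)]raddf_sum [coeff _ (\sum_(e in EE) _)]raddf_sum /=.
rewrite [X in _ = X - _](eq_bigr (fun e => right_slope (g e) 0
  + \sum_(k | (f k == e) && inner k) 1
  - (e \in EE)%:R)); last first.
  move=> e _; have [_ ->] := gPL e; rewrite sumL /= sumrN.
  by rewrite opprD opprK addrA; case: (e \in EE).
have -> : \sum_(e in EE) coeff (inl v) << edge_point e (y e) >> = 0 :> int.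
  apply: big1 => e /y01 y01e; rewrite coeff_point /edge_point.
  by case: insubP => // ; rewrite y01e.
have -> : \sum_k coeff (inl v) << edge_point (f k) (x k) >>
    = \sum_(e | src e == v) \sum_(k | f k == e) (x k == 0)%:R
      + \sum_(e | tgt e == v) \sum_(k | f k == e) (x k == 1)%:R :> int.
  have fiber (h : edge G -> vert G) (c : R) :
      \sum_(e | h e == v) \sum_(k | f k == e) (x k == c)%:R
      = \sum_(k | h (f k) == v) (x k == c)%:R :> int.
    rewrite [RHS](partition_big f (fun e => h e == v)) //=.
    apply: eq_bigr => e /eqP hv; apply: eq_bigl => k.
    by case: eqP => [->|]; rewrite ?hv ?eqxx ?andbF.
  rewrite !fiber [X in _ = X + _]big_mkcond [X in _ = _ + X]big_mkcond.
  rewrite -big_split /=; apply: eq_bigr => k _; rewrite coeff_point edge_point_vertex //.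
  case: (innerP k) => [->|->|/andP[/lt0r_neq0/negbTE -> ]].
  - rewrite eqxx [0 == 1]eq_sym oner_eq0 orbF if_same addr0.
    by case: (src _ == v).
  - by rewrite eqxx oner_eq0 if_same add0r; case: (tgt _ == v).
  - by rewrite lt_neqAle => /andP[/negbTE -> _]; rewrite !if_same.
have mE e : \sum_(k | f k == e) 1 = \sum_(k | f k == e) (x k == 0)%:R
    + \sum_(k | (f k == e) && inner k) 1
    + \sum_(k | f k == e) (x k == 1)%:R :> int.
  rewrite big_mkcondr -!big_split /=; apply: eq_bigr => k _; rewrite /inner.
  case: (innerP k) => [->|->|xk].
  - by rewrite ltxx eqxx [0 == 1]eq_sym oner_eq0.
  - by rewrite ltxx eqxx oner_eq0 andbF.
  - rewrite [0 < _ < _]xk; have /andP[/lt0r_neq0 /negbTE -> ] := xk.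
    by rewrite lt_neqAle => /andP[/negbTE -> _].
rewrite !sumrB !big_split /= => FDv.
have sE e : sigma e = right_slope (g e) 0 - \sum_(k | f k == e) (x k == 0)%:R.
  by rewrite ffunE.
rewrite ffunE; under [X in X - _ = _]eq_bigr do rewrite sE.
under [X in _ - X = _]eq_bigr do rewrite sE.
under [X in _ = _ - (X - _)]eq_bigr do rewrite mE.
rewrite !sumrB !big_split /=.
have rearrange (a b c h r i m s z : int) :
    a - (c + h) - (b - 0) = r + i - m - s ->
    r - z - (s - c) = a - b - (z + i + h - m) by lia.
exact: rearrange FDv.
Qed.

End Lift.

(** * Local constancy of the initial slopes *)

(** Connectedness of the segment, for a relation [L] that is total and locally single-valued and
    constant. [near_val P] is the union of the balls on which the value is fixed and satisfies
    [P]. *)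
Lemma locally_constant_segment (R : realType) (T : Type) (L : R -> T -> Prop)
    (t t' : T) :
  (forall s, 0 <= s <= 1 -> exists u, L s u) ->
  (forall s u, 0 <= s <= 1 -> L s u -> exists2 h, 0 < h &
     forall s' u', 0 <= s' <= 1 -> `|s' - s| < h -> L s' u' -> u' = u) ->
  L 0 t -> L 1 t' -> t' = t.
Proof.
move=> Lex Lloc L0 L1.
pose near_val (P : T -> Prop) : set R := [set r | exists s u h,
  [/\ 0 <= s <= 1, L s u, P u, `|r - s| < h &
     forall s' u', 0 <= s' <= 1 -> `|s' - s| < h -> L s' u' -> u' = u]].
have near_val_open P : open (near_val P).
  rewrite openE => r [s [u [h [s01 Ls Pu rs hu]]]].
  apply/nbhs_ballP; exists (h - `|r - s|); first by rewrite /= subr_gt0.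
  move=> r' /=; rewrite /ball /= => rr'; exists s, u, h; split=> //.
  rewrite (_ : r' - s = (r - s) - (r - r')); last by ring.
  by rewrite (le_lt_trans (ler_normB _ _)) // -ltrBrDl.
have near_val_L P s u : 0 <= s <= 1 -> L s u -> P u -> near_val P s.
  move=> s01 Ls Pu; have [h h0 hu] := Lloc s u s01 Ls.
  by exists s, u, h; rewrite subrr normr0.
have L_near_val P s u : 0 <= s <= 1 -> L s u -> near_val P s -> P u.
  by move=> s01 Ls [s' [u' [h [s'01 _ Pu' ss' hu']]]]; rewrite (hu' s u).
pose B : set R := `[0, 1] `&` near_val (fun u => u = t).
have BE : B = `[0, 1]%classic.
  apply: (@segment_connected R 0 1).
  - exists 0; split; first by rewrite /= in_itv /= lexx ler01.
    by apply: (near_val_L _ 0 t) => //; rewrite lexx ler01.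
  - by exists (near_val (fun u => u = t)).
  (* Every point of the segment has a value, so there the complement of [near_val] for [u = t] is
     the open set [near_val] for [u <> t]. *)
  - exists (~` near_val (fun u => u <> t)); first exact: open_closedC.
    rewrite /B; apply/seteqP; split=> s [s01]; have := s01;
      rewrite /= in_itv /= => s01'; have [u Ls] := Lex s s01' => nv.
    + split=> // nv'; have ut := L_near_val _ s u s01' Ls nv.
      exact: (L_near_val _ s u s01' Ls nv' ut).
    + split=> //; apply: (near_val_L _ s u) => //; apply: contrapT => ut.
      by apply: nv; exact: (near_val_L _ s u).
have [_] : B 1 by rewrite BE /= in_itv /= lexx ler01.
by apply: (L_near_val _ 1 t'); rewrite ?ler01 ?lexx.
Qed.

(** A nonzero integer has absolute value at least 1, so adding [x] does not change its sign. *)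
Lemma sqr_perturbation (R : realType) (c : int) (x : R) : `|x| < 1 ->
  0 <= c%:~R * (c%:~R + x) /\ (c%:~R * (c%:~R + x) = 0 -> c = 0).
Proof.
rewrite ltr_norml => /andP[x1 x2].
have [c0|c0|->] := ltgtP c 0; last by rewrite mul0r.
  have c1 : c%:~R <= -1 :> R by rewrite -(rmorphN1 intr) ler_int; lia.
  have : 0 < c%:~R * (c%:~R + x) by rewrite nmulr_rgt0; lra.
  by move=> p0; split=> [|E]; [exact: ltW | rewrite E ltxx in p0].
have c1 : 1 <= c%:~R :> R by rewrite -(rmorph1 intr) ler_int; lia.
have : 0 < c%:~R * (c%:~R + x) by rewrite pmulr_rgt0; lra.
by move=> p0; split=> [|E]; [exact: ltW | rewrite E ltxx in p0].
Qed.

Lemma exists_margin (R : realType) (T : finType) (P : pred T) (F : T -> R) :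
  (forall i, P i -> 0 < F i) ->
  exists2 m : R, 0 < m <= 1 & forall i, P i -> m <= F i.
Proof.
move=> F0; exists (\big[Num.min/1]_(i | P i) F i); last first.
  by move=> i Pi; exact: bigmin_le_cond.
rewrite bigmin_le_id andbT.
by elim/big_ind: _ => // x y x0 y0; rewrite lt_min x0.
Qed.

Section LiftConstant.
Variables (R : realType) (G : graph) (d : nat) (f : 'I_d -> edge G).
Variables (Ddag : divisor G) (EE : {set edge G}) (D : divisor (subdivision EE)).
Let is_lift := @is_lift R G d f Ddag EE D.

(* The difference of two lifts is an integral cycle, hence orthogonal to the
   difference of the potentials, which it approximates up to an error that is
   less than 1 on every edge. *)
Lemma lift_locally_constant (x : 'I_d -> R) sigma : is_lift x sigma ->
  exists2 h, 0 < h & forall x' sigma',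
    (forall k, `|x' k - x k| < h) -> is_lift x' sigma' -> sigma' = sigma.
Proof.
move=> [y [g [y01 bs gE]]].
have [|m /andP[m0 m1] my] :=
    @exists_margin R _ (mem EE) (fun e => Num.min (y e) (1 - y e)).
  by move=> e /y01 /andP[ye0 ye1]; rewrite lt_min ye0 subr_gt0.
(* At most [d] points lie on an edge, so together they move by less than [m]; dividing by [d.+1]
   also covers [d = 0]. *)
exists (m / d.+1%:R); first by rewrite divr_gt0 ?ltr0n.
move=> x' sigma' xx' [y' [g' [y'01 bs' gE']]].
pose c e := sigma' e - sigma e.
pose err e := (g' (tgt e) - g (tgt e)) - (g' (src e) - g (src e)) - (c e)%:~R.
have err1 e : `|err e| < 1.
  have errE : err e = \sum_(k | f k == e) (x k - x' k)
      + (if e \in EE then y' e - y e else 0).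
    have -> : err e = (g' (tgt e) - g' (src e)) - (g (tgt e) - g (src e))
      - (c e)%:~R by rewrite /err; ring.
    have -> : \sum_(k | f k == e) (x k - x' k)
        = \sum_(k | f k == e) (1 - x' k) - \sum_(k | f k == e) (1 - x k).
      by rewrite -sumrB; apply: eq_bigr => k _; ring.
    by rewrite gE gE' /c rmorphB /=; case: (e \in EE); ring.
  have sum_m : `|\sum_(k | f k == e) (x k - x' k)| < m.
    apply: le_lt_trans (ler_norm_sum _ _ _) _.
    apply: (@le_lt_trans _ _ (\sum_(k < d) m / d.+1%:R)).
      rewrite big_mkcond /=; apply: ler_sum => k _.
      case: ifP => _; last by rewrite ltW // divr_gt0 ?ltr0n.
      by rewrite distrC ltW.
    rewrite sumr_const card_ord -(mulr_natr _ d) mulrAC ltr_pdivrMr ?ltr0n //.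
    by rewrite ltr_pM2l // ltr_nat.
  rewrite errE; move: sum_m; case: ifP => [eE|_] sum_m; last first.
    by rewrite addr0 (lt_le_trans sum_m).
  (* As [y e] is at distance at least [m] from 0 and 1, [y' e - y e] is below [1 - m] in absolute
     value, which leaves room for the error [m]. *)
  have := my e eE; rewrite le_min => /andP[mye mye'].
  have /andP[y'0 y'1] := y'01 e eE.
  move: sum_m mye mye' y'0 y'1; move: (y e) (y' e) (\sum_(k | _) _) => a b u.
  by rewrite !ltr_norml => /andP[u1 u2] *; apply/andP; split; lra.
have sum0 : \sum_e (c e)%:~R * ((c e)%:~R + err e) = 0.
  under eq_bigr do rewrite addrC subrK.
  rewrite -(sum_boundary (fun e => (c e)%:~R) (fun v => g' v - g v)).
  apply: big1 => v _; rewrite -!(rmorph_sum intr) -rmorphB /=.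
  have := bs' v; rewrite -bs => /eqP; rewrite -subr_eq0 !ffunE => /eqP bss.
  have -> : \sum_(e | tgt e == v) c e - \sum_(e | src e == v) c e = 0.
    by rewrite -[RHS]bss /c !sumrB; ring.
  by rewrite mulr0.
apply/ffunP => e; apply/eqP; rewrite -subr_eq0; apply/eqP.
have [_] := sqr_perturbation (c e) (err1 e); apply.
move/eqP: sum0; rewrite psumr_eq0 => [/allP/(_ e (mem_index_enum e))/eqP //|].
by move=> e' _; have [] := sqr_perturbation (c e') (err1 e').
Qed.

End LiftConstant.

(** The bound on [b k - a k] makes the parametrization 1-Lipschitz, so the radius of local constancy
    carries over to the parameter [s]. *)
Lemma lift_segment (R : realType) (G : graph) (d : nat) (f : 'I_d -> edge G)
    (Ddag : divisor G) (EE : {set edge G}) (D : divisor (subdivision EE))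
    (a b : 'I_d -> R) sigma sigma' :
  let L := is_lift f Ddag D in
  (forall k, `|b k - a k| <= 1) ->
  (forall s, 0 <= s <= 1 -> exists u, L (fun k => a k + s * (b k - a k)) u) ->
  L a sigma -> L b sigma' -> sigma' = sigma.
Proof.
move=> L ab Lex La Lb.
apply: (@locally_constant_segment _ _
  (fun s => L (fun k => a k + s * (b k - a k)))) => //=.
- move=> s u _ /lift_locally_constant[h h0 hu]; exists h => // s' u' _ ss'.
  apply: hu => k; apply: le_lt_trans ss'.
  rewrite (_ : _ - _ = (s' - s) * (b k - a k)); last by ring.
  by rewrite normrM ler_piMr.
- by rewrite (_ : (fun k => _) = a) //; apply/funext => k; ring.
- by rewrite (_ : (fun k => _) = b) //; apply/funext => k; ring.
Qed.

(** * Relative interiors of convex hulls *)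

Section ConvexHull.
Variables (R : realType) (d n : nat) (q : 'I_n.+1 -> 'rV[R]_d).

(** The extra coordinate 1 turns affine combinations of the [q i] into linear combinations of
    rows. *)
Let rows : 'M[R]_(n.+1, d + 1) := \matrix_i row_mx (q i) (const_mx 1).

Let homogenize (x : 'rV[R]_d) : 'rV[R]_(d + 1) := row_mx x (const_mx 1).

Let homogenizeEl x l : homogenize x 0 (lshift 1 l) = x 0 l.
Proof. exact: row_mxEl. Qed.

Let homogenizeEr x : homogenize x 0 (rshift d 0) = 1.
Proof. by rewrite /homogenize row_mxEr mxE. Qed.

Let homogenizeB x y j :
  (homogenize y - homogenize x) 0 j = homogenize y 0 j - homogenize x 0 j.
Proof. by rewrite mxE; congr (_ + _); rewrite mxE. Qed.

Let homogenizeZ (a : R) x j : (a *: homogenize x) 0 j = a * homogenize x 0 j.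
Proof. by rewrite [LHS]mxE. Qed.

Let homogenize_sum (I : finType) (c : I -> R) (p : I -> 'rV[R]_d) :
  \sum_i c i = 1 ->
  homogenize (\sum_i c i *: p i) = \sum_i c i *: homogenize (p i).
Proof.
move=> c1; rewrite /homogenize.
under [RHS]eq_bigr do rewrite scale_row_mx.
apply/rowP => j; rewrite summxE; case: (split_ordP j) => l ->.
  by rewrite row_mxEl summxE; apply: eq_bigr => i _; rewrite row_mxEl.
rewrite row_mxEr mxE -[LHS]c1; apply: eq_bigr => i _.
by rewrite row_mxEr !mxE mulr1.
Qed.

Let homogenize_affine (A : set 'rV[R]_d) (x : 'rV[R]_d) :
  (forall y, A y -> (homogenize y <= rows)%MS) -> affine_hull A x ->
  (homogenize x <= rows)%MS.
Proof.
move=> AN [m [p [c [Ap c1 ->]]]]; rewrite homogenize_sum //.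
by apply: summx_sub => i _; apply: scalemx_sub; exact: AN.
Qed.

(** A pseudo-inverse of [rows] gives coefficients for [y - x] that depend linearly on it; near [x]
    they are too small to make [c i + u 0 i] negative. *)
Lemma relative_interior_combination (c : 'I_n.+1 -> R) :
  (forall i, 0 < c i) -> \sum_i c i = 1 ->
  relative_interior (convex_hull (range q)) (\sum_i c i *: q i).
Proof.
move=> c0 c1; set x := \sum_i _.
have rowsE i : row i rows = homogenize (q i) by rewrite rowK.
have rangeN y : range q y -> (homogenize y <= rows)%MS.
  by case=> i _ <-; rewrite -rowsE row_sub.
have hullN y : affine_hull (convex_hull (range q)) y ->
    (homogenize y <= rows)%MS.
  apply: homogenize_affine => z [m [p [b [pq _ b1 zE]]]].
  by apply: homogenize_affine rangeN _; exists m, p, b.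
have hxE : homogenize x = \sum_i c i *: row i rows.
  by rewrite homogenize_sum //; under [RHS]eq_bigr do rewrite rowsE.
split.
  by exists n.+1, q, c; split=> // i; exact: ltW.
(* [m] bounds the [c i] from below and [K] dominates the entries of the pseudo-inverse, so radius
   [m / K] yields [u_small]. *)
have [m /andP[m0 _] mc] := exists_margin (P := predT) (fun i _ => c0 i).
pose K := 1 + \sum_i \sum_l `|pinvmx rows (lshift 1 l) i|.
have K0 : 0 < K by rewrite ltr_pwDl // sumr_ge0 // => i _; rewrite sumr_ge0.
apply/nbhs_ballP; exists (m / K) => [|y xy]; first by rewrite /= divr_gt0.
move=> /hullN yN.
pose u := (homogenize y - homogenize x) *m pinvmx rows.
have uE : u *m rows = homogenize y - homogenize x.
  apply: mulmxKpV; rewrite addmx_sub // eqmx_opp.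
  by rewrite hxE; apply: summx_sub => i _; apply: scalemx_sub; exact: row_sub.
have u_small i : `|u 0 i| <= c i.
  have -> : u 0 i = \sum_l (y 0 l - x 0 l) * pinvmx rows (lshift 1 l) i.
    rewrite mxE big_split_ord /= [X in _ + X]big1 ?addr0 => [|l _].
      by apply: eq_bigr => l _; rewrite homogenizeB !homogenizeEl.
    by rewrite ord1 homogenizeB !homogenizeEr subrr mul0r.
  apply: le_trans (ler_norm_sum _ _ _) _.
  apply: (@le_trans _ _ (\sum_l m / K * `|pinvmx rows (lshift 1 l) i|)).
    apply: ler_sum => l _; rewrite normrM ler_wpM2r //.
    by case: xy => _ /(_ 0 l); rewrite /ball /= distrC => /ltW.
  apply: le_trans (mc i isT); rewrite -mulr_sumr mulrAC ler_pdivrMr //.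
  rewrite ler_wpM2l ?(ltW m0) //.
  rewrite /K (bigD1 i) //= addrCA lerDl addr_ge0 // sumr_ge0 // => j _.
  by rewrite sumr_ge0.
have hyE : homogenize y = \sum_i (c i + u 0 i) *: row i rows.
  rewrite -[LHS](subrK (homogenize x)) -uE mulmx_sum_row hxE -big_split /=.
  by apply: eq_bigr => i _; rewrite addrC scalerDl.
exists n.+1, q, (fun i => c i + u 0 i); split.
- by move=> i; exists i.
- move=> i; have := u_small i; rewrite ler_norml => /andP[].
  by rewrite lerNl -subr_ge0 opprK addrC.
- have := congr1 (fun z : 'rV[R]_(d + 1) => z 0 (rshift d 0)) hyE.
  rewrite /= homogenizeEr summxE => ->; apply: eq_bigr => i _.
  by rewrite rowsE homogenizeZ homogenizeEr mulr1.
- apply/rowP => l.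
  have := congr1 (fun z : 'rV[R]_(d + 1) => z 0 (lshift 1 l)) hyE.
  rewrite /= homogenizeEl summxE => ->; rewrite summxE.
  by apply: eq_bigr => i _; rewrite rowsE homogenizeZ homogenizeEl [RHS]mxE.
Qed.

End ConvexHull.

(* Some translate [c] keeps all the values [g v + c] away from the integers:
   of the translates by j / (#|V| + 1), each [v] spoils at most one. *)
Lemma exists_floor_shift (R : realType) (V : finType) (g : V -> R) :
  let h := (2 * #|V|.+1%:R)^-1 in
  exists (c : R) (M : V -> int),
    forall v, (M v)%:~R + h <= g v + c <= (M v)%:~R + 1 - h.
Proof.
move=> h; pose N := #|V|.+1.
have N0 : 0 < N%:R :> R by rewrite ltr0n.
pose shift (j : 'I_N) : R := j%:R / N%:R.
pose good j v := let m : R := (Num.floor (g v + shift j))%:~R in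
  m + h <= g v + shift j <= m + 1 - h.
have [/existsP[j /forallP jP]|bad] := boolP [exists j, forall v, good j v].
  by exists (shift j), (fun v => Num.floor (g v + shift j)).
exfalso.
have near_int j v : ~~ good j v ->
    exists a : int, `|g v + shift j - a%:~R| < h.
  rewrite /good negb_and -!ltNge; move: (g v + shift j) => r.
  have := Num.Theory.floor_le r; have := Num.Theory.floorD1_gt r.
  rewrite rmorphD /= => r1 r0 /orP[rh|rh]; [exists (Num.floor r) |
    exists (Num.floor r + 1)]; rewrite ?rmorphD /= ltr_norml;
    move: r1 r0 rh; move: ((Num.floor r)%:~R : R) => m *;
    apply/andP; split; lra.
have /choice[w wP] : forall j : 'I_N, exists v, ~~ good j v.
  move=> j; apply/existsP; rewrite -negb_forall; move: bad.
  by rewrite negb_exists => /forallP.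
(* Pigeonhole: if [i] and [j] spoil the same vertex, [(i - j) / N] is within [2 * h = 1 / N] of the
   integer [a - b], which forces [i = j]. *)
have : (#|'I_N| <= #|V|)%N.
  apply: (@leq_card _ _ w) => i j wij.
  have [a aP] := near_int _ _ (wP i); have [b bP] := near_int _ _ (wP j).
  rewrite wij in aP.
  have : `|(i%:Z - j%:Z - N%:Z * (a - b))%:~R : R| < 1.
    have -> : (i%:Z - j%:Z - N%:Z * (a - b))%:~R = N%:R *
       ((g (w j) + shift i - a%:~R) - (g (w j) + shift j - b%:~R)) :> R.
      rewrite /shift !rmorphB rmorphM /= rmorphB /= -!pmulrn.
      by field; rewrite lt0r_neq0.
    rewrite normrM gtr0_norm // mulrC -ltr_pdivlMr //.
    apply: le_lt_trans (ler_normB _ _) _.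
    rewrite (_ : 1 / N%:R = h + h) ?ltrD // /h -/N.
    by field; rewrite lt0r_neq0.
  rewrite ltr_norml -(rmorphN1 intr) -(rmorph1 intr) !ltr_int => /andP[l1 l2].
  have iN := ltn_ord i; have jN := ltn_ord j.
  have ijE : i%:Z - j%:Z = N%:Z * (a - b) by lia.
  apply: val_inj => /=.
  have [ab|ab|ab] := ltgtP (a - b) 0; [nia | nia | rewrite ab in ijE; lia].
by rewrite card_ord ltnn.
Qed.

(** * Vertices of the hypercube *)

Section Vertices.
Variables (G : graph) (d : nat) (f : 'I_d -> edge G).
Implicit Types (Q : {ffun 'I_d -> bool}) (e : edge G) (W : {set vert G}).

Definition multiplicity e : int := \sum_(k | f k == e) 1.

Definition at_source Q e : int := \sum_(k | f k == e) (~~ Q k)%:R.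

Lemma sum_multiplicity : \sum_e multiplicity e = d%:Z.
Proof.
transitivity (\sum_(k < d) (1 : int)); last by rewrite sumr_const card_ord natz.
by rewrite [RHS](partition_big f predT).
Qed.

Lemma div_vertexE Q v : div_vertex f Q v = - \sum_k (label f Q k == v)%:R.
Proof.
rewrite ffunE -sum1_card -natz natr_sum big_mkcond /=.
by congr (- _); apply: eq_bigr => k _; rewrite inE; case: eqP.
Qed.

Lemma degree_div_vertex Q : degree (div_vertex f Q) = - d%:Z.
Proof.
rewrite /degree; under eq_bigr do rewrite div_vertexE.
rewrite sumrN exchange_big /= (eq_bigr (fun=> 1)) => [|k _].
  by rewrite sumr_const card_ord natz.
by rewrite (bigD1 (label f Q k)) //= eqxx big1 ?addr0 // => v /negbTE;
  rewrite eq_sym => ->.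
Qed.

(** All labels are first put at the targets of their edges; those at sources are then moved back
    along the edge. *)
Lemma div_vertex_boundary Q v : div_vertex f Q v
  = - \sum_(e | tgt e == v) multiplicity e
    - boundary [ffun e => - at_source Q e] v.
Proof.
have fiber (h : edge G -> vert G) (c : 'I_d -> int) :
    \sum_(e | h e == v) \sum_(k | f k == e) c k = \sum_(k | h (f k) == v) c k.
  rewrite [RHS](partition_big f (fun e => h e == v)) //=.
  apply: eq_bigr => e /eqP hv; apply: eq_bigl => k.
  by case: eqP => [->|]; rewrite ?hv ?eqxx ?andbF.
have labelE : \sum_k (label f Q k == v)%:R = \sum_(k | tgt (f k) == v) 1
    - \sum_(k | tgt (f k) == v) (~~ Q k)%:R
    + \sum_(k | src (f k) == v) (~~ Q k)%:R :> int.
  rewrite -sumrB [X in _ = X + _]big_mkcond [X in _ = _ + X]big_mkcond.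
  rewrite -big_split /=.
  apply: eq_bigr => k _; rewrite /label.
  by case: (Q k); case: (tgt _ == v); case: (src _ == v).
rewrite div_vertexE labelE -!fiber ffunE /multiplicity /at_source.
under [X in _ - (X - _)]eq_bigr do rewrite ffunE.
under [X in _ - (_ - X)]eq_bigr do rewrite ffunE.
by rewrite !sumrN; ring.
Qed.

Lemma a_at_target Q e : tgt e != src e ->
  (a_at f Q e (tgt e))%:Z = multiplicity e - at_source Q e.
Proof.
move=> ts; rewrite /a_at -sum1_card -natz natr_sum /multiplicity /at_source.
rewrite -sumrB big_mkcond [RHS]big_mkcond /=; apply: eq_bigr => k _.
rewrite inE; case: eqP => //= fk; rewrite /label fk.
by case: (Q k); rewrite ?eqxx // eq_sym (negbTE ts).
Qed.

Lemma a_onE Q e W : (a_on f Q e W)%:Z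
  = (tgt e \notin W)%:R * multiplicity e
    + ((tgt e \in W)%:R - (src e \in W)%:R) * at_source Q e.
Proof.
rewrite /a_on -sum1_card -natz natr_sum /multiplicity /at_source.
rewrite !mulr_sumr -big_split big_mkcond [RHS]big_mkcond /=.
apply: eq_bigr => k _; rewrite inE; case: eqP => //= fk; rewrite /label fk.
by case: (Q k); case: (tgt e \in W); case: (src e \in W).
Qed.

End Vertices.

(** * Quasistable corners of a cell and potentials near cube vertices *)

Section CellCorners.
Variables (R : realType) (G : graph) (v0 : vert G) (k : int) (mu : vert G -> R).
Variables (d : nat) (f : 'I_d -> edge G) (Ddag : divisor G).
Variables (EE : {set edge G}) (D : divisor (subdivision EE)).
Hypothesis mu_k : polarization k mu.
Hypothesis Ddag_k : degree Ddag = k + d%:Z.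
Hypothesis D_qs : quasistable_pseudo_divisor v0 k mu D.

Let corner (U : {set edge G}) : divisor G :=
  specialize D (fun e => if e \in U then src e else tgt e).

Let indicator (U : {set edge G}) : {ffun edge G -> int} :=
  [ffun e => (e \in U)%:R].

Lemma quasistable_corner U : quasistable v0 mu (corner U).
Proof.
have [pD _ qD] := D_qs; apply: quasistable_specialize => // e _.
by case: ifP; [left | right].
Qed.

(** The equation for [boundary sigma] puts all exceptional vertices at the targets; moving the one
    of [e] to the source adds the boundary of [e] to the divisor. *)
Lemma corner_lift (x : 'I_d -> R) sigma (U : {set edge G}) : U \subset EE ->
  is_lift f Ddag D x sigma ->
  corner U = Ddag - [ffun v => \sum_(e | tgt e == v) multiplicity f e]
             - boundary (sigma - indicator U).
Proof.
move=> /fintype.subsetP UE [y [g [_ bs _]]]; apply/ffunP => v.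
have cornerE : \sum_(e in EE) ((if e \in U then src e else tgt e) == v)%:R
    = \sum_(e | tgt e == v) (e \in EE)%:R - boundary (indicator U) v :> int.
  rewrite ffunE opprB addrCA -sumrB big_mkcond [X in _ = X + _]big_mkcond.
  rewrite [X in _ = _ + X]big_mkcond -big_split /=; apply: eq_bigr => e _.
  rewrite !ffunE; have [/UE ->|_] := boolP (e \in U).
    by case: (src e == v); case: (tgt e == v).
  by case: (e \in EE); case: (src e == v); case: (tgt e == v).
have subE (A B : divisor G) : (A - B) v = A v - B v by rewrite !ffunE.
rewrite boundaryB [LHS]ffunE cornerE !subE [X in _ = _ - X - _]ffunE bs sumrB.
by rewrite /multiplicity; ring.
Qed.

Lemma lift_near_vertex sigma (Q : {ffun 'I_d -> bool}) :
  (forall h : R, 0 < h -> exists2 x, (forall k, `|x k - (Q k)%:R| < h)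
                              & is_lift f Ddag D x sigma) ->
  exists2 U : {set edge G}, U \subset EE & forall e,
    b_at v0 mu f Ddag Q e = sigma e + at_source f Q e - (e \in U)%:R.
Proof.
move=> near_Q.
pose h : R := (2 * #|vert G|.+1%:R)^-1.
have h0 : 0 < h by rewrite invr_gt0 mulr_gt0 ?ltr0n.
have [|x xQ Lx] := near_Q (h / d.+1%:R); first by rewrite divr_gt0 ?ltr0n.
have [y [g [y01 bs gE]]] := Lx.
have [c [M MP]] := exists_floor_shift g.
(* The rounding error. Rounding changes a difference of potentials by at most [1 - 2 * h] and the
   points by less than [h], so only the term [1 - y e], present on [EE], can bring [chi] to -1. *)
pose chi e := M (tgt e) - M (src e) - sigma e - at_source f Q e.
have sum_h e : `|\sum_(k | f k == e) (1 - x k) - (at_source f Q e)%:~R| < h.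
  rewrite /at_source rmorph_sum -sumrB /=.
  apply: le_lt_trans (ler_norm_sum _ _ _) _.
  apply: (@le_lt_trans _ _ (\sum_(j < d) h / d.+1%:R)).
    rewrite big_mkcond /=; apply: ler_sum => j _.
    case: ifP => _; last by rewrite ltW // divr_gt0 ?ltr0n.
    rewrite (_ : _ - _ = - (x j - (Q j)%:R)) ?normrN ?ltW //.
    by case: (Q j) => /=; ring.
  rewrite sumr_const card_ord -(mulr_natr _ d) mulrAC ltr_pdivrMr ?ltr0n //.
  by rewrite ltr_pM2l // ltr_nat.
have chiP e : chi e = 0 \/ (e \in EE) /\ chi e = -1.
  have := sum_h e; have := gE e; have := MP (tgt e); have := MP (src e).
  rewrite -/h.
  have chiE : (chi e)%:~R = (M (tgt e))%:~R - (M (src e))%:~R - (sigma e)%:~R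
    - (at_source f Q e)%:~R :> R by rewrite /chi !rmorphB.
  rewrite ltr_norml => /andP[s1 s2] /andP[t1 t2] E /andP[u1 u2].
  have chi_lt : chi e < 1.
    rewrite -(ltr_int R) chiE; case: ifP E => [/y01 /andP[y0 y1]|_] E; lra.
  have [eE|eE] := boolP (e \in EE).
    have /andP[y0 y1] := y01 e eE.
    have chi_gt : -2 < chi e.
      by rewrite -(ltr_int R) chiE rmorphN /=; rewrite eE in E; lra.
    by have [|] : chi e = 0 \/ chi e = -1 by [lia]; [left | right].
  have chi_gt : -1 < chi e.
    by rewrite -(ltr_int R) chiE; rewrite (negbTE eE) in E; lra.
  by left; lia.
pose U : {set edge G} := [set e in EE | chi e == -1]%SET.
have UE : U \subset EE by apply/fintype.subsetP => e; rewrite inE => /andP[].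
exists U => // e.
pose Mf : {ffun vert G -> int} := [ffun v => M v].
have dM : coboundary Mf = sigma - indicator U - [ffun e => - at_source f Q e].
  apply/ffunP => e'; rewrite !ffunE inE opprK.
  by have [cE|[eE cE]] := chiP e'; rewrite cE ?eE ?andbF /=; move: cE;
    rewrite /chi; lia.
rewrite /b_at (@phi_quasistable _ _ _ k _ _ _ Mf) //.
- by rewrite dM !ffunE opprK addrAC.
- rewrite /degree; under eq_bigr do rewrite ffunE.
  by rewrite big_split /= -!/(degree _) degree_div_vertex Ddag_k addrK.
- suff -> : Ddag + div_vertex f Q - boundary (coboundary Mf) = corner U.
    exact: quasistable_corner.
  rewrite dM (boundaryB (sigma - _)) (corner_lift UE Lx); apply/ffunP => v.
  have subE (A B : divisor G) : (A - B) v = A v - B v by rewrite !ffunE.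
  have addE (A B : divisor G) : (A + B) v = A v + B v by rewrite !ffunE.
  rewrite !subE addE (div_vertex_boundary f Q v) [X in _ = _ - X - _]ffunE.
  by ring.
Qed.

(** The middle term is [beta] of the corner on [W] minus half of the cut. The strict lower bound is
    quasistability at [W], and the upper bound is quasistability at [~: W] through [beta_setC]. *)
Lemma corner_bound (x : 'I_d -> R) sigma (U : {set edge G}) (W : {set vert G}) :
  is_lift f Ddag D x sigma -> U \subset EE ->
  W \proper [set: vert G]%SET -> v0 \in W ->
  - ((cut_size W)%:R / 2)
    < (deg_on Ddag W)%:~R - mu_on mu W - d%:R
      + (\sum_e ((tgt e \notin W)%:R * multiplicity f e
                 - (sigma e - (e \in U)%:R)
                   * ((tgt e \in W)%:R - (src e \in W)%:R)))%:~R
    <= (cut_size W)%:R / 2.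
Proof.
move=> Lx UE Wp v0W.
have qsU := quasistable_corner U; have cornerE := corner_lift UE Lx.
have WCp : (~: W)%SET \proper [set: vert G]%SET.
  apply/properP; split; first exact: finset.subsetT.
  by exists v0; rewrite // !inE v0W.
have degU : degree (corner U) = k.
  have [pD Dk _] := D_qs; rewrite degree_setT deg_on_specialize // -Dk /degree.
  rewrite big_sumType /=; congr (_ + _).
    by apply: eq_bigl => v; rewrite inE.
  rewrite -sumrN big_sub; apply: eq_bigr => z _.
  by rewrite inE [RHS]pD.
have deg_onU : deg_on (corner U) W = deg_on Ddag W - d%:Z
    + \sum_e ((tgt e \notin W)%:R * multiplicity f e
       - (sigma e - (e \in U)%:R) * ((tgt e \in W)%:R - (src e \in W)%:R)).
  rewrite cornerE !deg_onB deg_on_boundary -(sum_multiplicity f) sumrB.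
  have -> : deg_on [ffun v => \sum_(e | tgt e == v) multiplicity f e] W
      = \sum_e multiplicity f e - \sum_e (tgt e \notin W)%:R * multiplicity f e.
    rewrite -sumrB /deg_on; under eq_bigr do rewrite ffunE.
    rewrite [RHS](bigID (fun e => tgt e \in W)) /= [X in _ = _ + X]big1 ?addr0.
      rewrite [RHS](partition_big (@tgt G) (mem W)) //=; apply: eq_bigr => v vW.
      apply: eq_big => [e|e /eqP ->]; last by rewrite vW mul0r subr0.
      by case: eqP => [->|]; rewrite ?vW ?andbF.
    by move=> e ->; rewrite mul1r subrr.
  under [X in _ - X = _]eq_bigr do rewrite !ffunE.
  by ring.
have -> : (deg_on Ddag W)%:~R - mu_on mu W - d%:R
    + (\sum_e ((tgt e \notin W)%:R * multiplicity f e
        - (sigma e - (e \in U)%:R)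
          * ((tgt e \in W)%:R - (src e \in W)%:R)))%:~R
    = beta mu (corner U) W - (cut_size W)%:R / 2.
  rewrite /beta deg_onU rmorphD rmorphB /= -pmulrn; ring.
have [bW bW0] := qsU _ Wp; have [bWC _] := qsU _ WCp.
have betaC := beta_setC mu_k W degU.
have cut2 : (cut_size W)%:R = (cut_size W)%:R / 2 + (cut_size W)%:R / 2 :> R.
  by field.
apply/andP; split; first by rewrite -subr_gt0 opprK subrK bW0.
by rewrite lerBlDr -cut2 -betaC lerDl.
Qed.

End CellCorners.

(** * A common lift over the interior of the hull, and the two estimates *)

Theorem theorem4p25 (R : realType) (G : graph) (v0 : vert G) (k : int)
  (d n : nat) (Ddag : divisor G) (mu : vert G -> R) (f : 'I_d -> edge G)
  (Q : 'I_n.+1 -> {ffun 'I_d -> bool}) (EE : {set edge G})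
  (D : divisor (subdivision EE)) :
  graph_connected G ->
  degree Ddag = k + d%:Z ->
  polarization k mu ->
  injective Q ->
  quasistable_pseudo_divisor v0 k mu D ->
  (fun x => tropical_abel (induced_divisor R Ddag) (cube_map f x))
    @` relative_interior (convex_hull (range (fun i => cube_vertex R (Q i))))
    `<=` open_cell R D ->
  (forall (i j : 'I_n.+1) (e : edge G),
     `| ((a_at f (Q i) e (tgt e))%:Z + b_at v0 mu f Ddag (Q i) e)
        - ((a_at f (Q j) e (tgt e))%:Z + b_at v0 mu f Ddag (Q j) e) | <= 1)
  /\
  (forall (j : edge G -> 'I_n.+1) (W : {set vert G}),
     W \proper [set: vert G]%SET -> v0 \in W ->
     - ((cut_size W)%:R / 2)
       < (deg_on Ddag W)%:~R - mu_on mu W - d%:R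
         + (\sum_(e : edge G)
              ((a_on f (Q (j e)) e W)%:Z
               - b_on v0 mu f Ddag (Q (j e)) e W))%:~R
       <= (cut_size W)%:R / 2).
Proof.
move=> _ Ddag_k mu_k _ D_qs abel_cell.
pose q i := cube_vertex R (Q i).
pose inner (x : 'rV[R]_d) := exists c : 'I_n.+1 -> R,
  [/\ forall i, 0 < c i, \sum_i c i = 1 & x = \sum_i c i *: q i].
have q01 i l : 0 <= q i 0 l <= 1.
  by rewrite mxE; case: (Q i l); rewrite lexx ler01.
have inner01 x l : inner x -> 0 <= x 0 l <= 1.
  case=> c [c0 c1 ->]; rewrite summxE; apply/andP; split.
    by apply: sumr_ge0 => i _; rewrite mxE mulr_ge0 ?(ltW (c0 i)) //;
      case/andP: (q01 i l).
  rewrite -c1; apply: ler_sum => i _; rewrite mxE ler_piMr ?(ltW (c0 i)) //.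
  by case/andP: (q01 i l).
have innerL x : inner x -> exists sigma, is_lift f Ddag D (x 0) sigma.
  move=> xU; apply: open_cell_lift => [l|]; first exact: inner01.
  apply: abel_cell; exists x => //.
  by case: xU => c [c0 c1 ->]; exact: relative_interior_combination.
have inner_segment x (c : 'I_n.+1 -> R) s : inner x ->
    (forall i, 0 <= c i) -> \sum_i c i = 1 -> 0 <= s < 1 ->
    inner (x + s *: (\sum_i c i *: q i - x)).
  move=> [b [b0 b1 ->]] c0 c1 /andP[s0 s1].
  exists (fun i => b i + s * (c i - b i)); split.
  - move=> i; rewrite (_ : _ + _ = (1 - s) * b i + s * c i); last by ring.
    by rewrite ltr_wpDr ?mulr_ge0 // mulr_gt0 ?subr_gt0.
  - by rewrite big_split -mulr_sumr sumrB /= b1 c1 subrr mulr0 addr0.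
  - rewrite -sumrB scaler_sumr -big_split; apply: eq_bigr => i _ /=.
    by rewrite scalerDl -scalerBl scalerA.
pose x0 : 'rV[R]_d := \sum_i n.+1%:R^-1 *: q i.
have x0U : inner x0.
  exists (fun=> n.+1%:R^-1); split=> //.
  by rewrite sumr_const card_ord -[LHS]mulr_natl divff ?pnatr_eq0.
have [sigma Lx0] := innerL _ x0U.
have Lnear x : inner x -> is_lift f Ddag D (x 0) sigma.
  move=> xU; have [sigma' Lx] := innerL _ xU.
  rewrite -(_ : sigma' = sigma) //.
  apply: (lift_segment _ _ Lx0 Lx) => [l|s /andP[s0 s1]].
    have /andP[a0 a1] := inner01 _ l x0U; have /andP[b0 b1] := inner01 _ l xU.
    by rewrite ler_norml; apply/andP; split; lra.
  rewrite (_ : (fun l => _) = (x0 + s *: (x - x0)) 0); last first.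
    by apply/funext => l; rewrite !mxE.
  (* [inner_segment] stops short of [s = 1], where the point is [x] itself. *)
  move: s1; rewrite le_eqVlt => /predU1P[->|s1].
    by rewrite scale1r addrC subrK; exists sigma'.
  apply: innerL; case: (xU) => c [c0 c1 ->]; apply: inner_segment => //.
    by move=> i; exact: ltW.
  by rewrite s0.
have near_vertex i (h : R) : 0 < h -> exists2 x : 'I_d -> R,
    (forall l, `|x l - (Q i l)%:R| < h) & is_lift f Ddag D x sigma.
  (* The point at parameter [s] is within [1 - s <= h / 2] of [q i] in each coordinate; the maximum
     with 0 covers large [h]. *)
  move=> h0; pose s := Num.max (1 - h / 2) 0.
  have s01 : 0 <= s < 1 by rewrite le_max lexx orbT gt_max ltr01 andbT; lra.
  have sumq : q i = \sum_j (i == j)%:R *: q j.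
    rewrite (bigD1 i) //= eqxx scale1r big1 ?addr0 // => j /negbTE.
    by rewrite eq_sym => ->; rewrite scale0r.
  exists ((x0 + s *: (q i - x0)) 0).
    move=> l; have -> : (x0 + s *: (q i - x0)) 0 l - (Q i l)%:R
        = (1 - s) * (x0 0 l - q i 0 l) by rewrite !mxE; ring.
    have /andP[a0 a1] := inner01 _ l x0U; have /andP[b0 b1] := q01 i l.
    case/andP: s01 => s0 s1; rewrite normrM gtr0_norm ?subr_gt0 //.
    have sh : 1 - s <= h / 2 by rewrite lerBlDr -lerBlDl le_max lexx.
    apply: (@le_lt_trans _ _ (h / 2)); last by lra.
    apply: le_trans sh; rewrite ler_piMr ?subr_ge0 ?(ltW s1) //.
    by rewrite ler_norml; apply/andP; split; lra.
  apply: Lnear; rewrite sumq; apply: inner_segment => //.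
  rewrite (bigD1 i) //= eqxx big1 ?addr0 // => j /negbTE.
  by rewrite eq_sym => ->.
have /choice[U UP] : forall i, exists U : {set edge G}, U \subset EE /\
    forall e, b_at v0 mu f Ddag (Q i) e
      = sigma e + at_source f (Q i) e - (e \in U)%:R.
  move=> i; have [U UE bU] := lift_near_vertex mu_k Ddag_k D_qs (near_vertex i).
  by exists U.
split=> [i j e|j W Wp v0W].
  (* On a loop neither number depends on the vertex: every label is the target and [phi]
     vanishes. *)
  have [tse|ts] := eqVneq (tgt e) (src e).
    have a_loop i' : a_at f (Q i') e (tgt e) = #|[set l | f l == e]%SET|.
      rewrite /a_at; apply: eq_card => l; rewrite !inE.
      by case: eqP => //= fl; rewrite /label fl -tse if_same eqxx.
    have b_loop i' : b_at v0 mu f Ddag (Q i') e = 0.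
      by rewrite /b_at ffunE tse subrr.
    by rewrite !a_loop !b_loop subrr normr0.
  have [_ bi] := UP i; have [_ bj] := UP j.
  rewrite !a_at_target // bi bj.
  by case: (e \in U i); case: (e \in U j); lia.
(* After the [at_source] terms cancel, the summand at [e] depends on [j e] only through membership
   of [e] in [U (j e)], so one corner accounts for all the choices. *)
pose V : {set edge G} := [set e | e \in U (j e)]%SET.
have VE : V \subset EE.
  apply/fintype.subsetP => e; rewrite inE.
  by have [/fintype.subsetP/(_ e)] := UP (j e).
rewrite (eq_bigr (fun e => (tgt e \notin W)%:R * multiplicity f e
  - (sigma e - (e \in V)%:R) * ((tgt e \in W)%:R - (src e \in W)%:R))).
  by have := corner_bound mu_k D_qs Lx0 VE Wp v0W.
move=> e _.
rewrite a_onE /b_on; have [_ ->] := UP (j e); rewrite inE.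
by case: (tgt e \in W); case: (src e \in W) => /=; ring.
Qed.
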